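(* Consider the Erlang-A system. There exists an increasing function $C_W:\mathbb{R}_+\to\mathbb{R}_+$ such that for all integers $n\ge 1$ and all $\lambda>0$, $\mu>0$, $\alpha>0$ satisfying $R\ge 1$, $$d_W(\tilde X(\infty),Y(\infty))\le C_W(\alpha/\mu)\,\delta .$$
   Context: Erlang-A system: $n$ homogeneous servers, Poisson arrivals with rate $\lambda$, i.i.d. exponential service times with mean $1/\mu$, first-come-first-serve, and i.i.d. exponential patience times with mean $1/\alpha$, $\alpha>0$ (a customer whose waiting time in queue exceeds his patience time abandons). The customer count $X=\{X(t),t\ge0\}$ is the birth-death process on $\{0,1,2,\dots\}$ with birth rate $\lambda$ in every state and death rate $\mu(k\wedge n)+\alpha(k-n)^+$ in state $k$; it is positive recurrent and $X(\infty)$ denotes a random variable with its stationary distribution. Set $R=\lambda/\mu$, $\delta=1/\sqrt R$, and let $x(\infty)=n+\frac{\lambda-n\mu}{\alpha}$ if $R\ge n$ and $x(\infty)=R$ if $R<n$. Put $\tilde X(\infty)=\delta(X(\infty)-x(\infty))$ and $\zeta=\delta(x(\infty)-n)$. With $x^+=\max(x,0)$, $x^-=\max(-x,0)$, let $b(x)=\big((x+\zeta)^--\zeta^-\big)\mu-\big((x+\zeta)^+-\zeta^+\big)\alpha$. $Y(\infty)$ is a continuous random variable on $\mathbb{R}$ with density $\kappa\exp\big(\frac1\mu\int_0^xb(y)\,dy\big)$, $\kappa>0$ the normalizing constant. The Wasserstein distance is $d_W(U,V)=\sup_{h\in\mathrm{Lip}(1)}|\mathbb{E}h(U)-\mathbb{E}h(V)|$,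 where $\mathrm{Lip}(1)=\{h:\mathbb{R}\to\mathbb{R}:|h(x)-h(y)|\le|x-y|\}$. *)

(* Defs.v *)
From HB Require Import structures.
From mathcomp Require Import all_boot all_order all_algebra.
From mathcomp Require Import all_classical all_reals all_analysis.

Set Implicit Arguments.
Unset Strict Implicit.
Unset Printing Implicit Defensive.

Import Order.TTheory GRing.Theory Num.Theory.
Import numFieldNormedType.Exports.

Local Open Scope classical_set_scope.
Local Open Scope ring_scope.

(** * Continuous-time Markov chains on the nonnegative integers *)

(* [Pt t i A] is the probability of being in [A] at time [t] when starting
   from [i]; only times [t >= 0] matter. *)
Definition transition_function (R : realType) (Pt : R -> R.-pker nat ~> nat) :
    Prop :=
  (forall (i : nat) (A : set nat), Pt 0 i A = \d_i A) /\
  (forall (s t : R) (i : nat) (A : set nat), 0 <= s -> 0 <= t ->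
     Pt (s + t) i A = (\int[Pt s i]_j Pt t j A)%E).

(* The matrix of jump rates [q] is the right derivative at [t = 0] of the
   transition probabilities, diagonal entries included. *)
Definition has_rates (R : realType) (Pt : R -> R.-pker nat ~> nat)
    (q : nat -> nat -> R) : Prop :=
  forall i j : nat,
    (fine (Pt t i [set j]) - (i == j)%:R) / t @[t --> 0^'+] --> q i j.

Definition birth_death_rates (R : realType) (birth death : nat -> R)
    (i j : nat) : R :=
  if j == i.+1 then birth i
  else if i == j.+1 then death i
  else if i == j then
    - (birth i + (if i is 0%N then 0 else death i))
  else 0.

Definition birth_death_process (R : realType) (birth death : nat -> R)
    (Pt : R -> R.-pker nat ~> nat) : Prop :=
  transition_function Pt /\ has_rates Pt (birth_death_rates birth death).

Definition stationary (R : realType) (Pt : R -> R.-pker nat ~> nat)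
    (nu : probability nat R) : Prop :=
  forall (t : R) (A : set nat), 0 <= t -> (\int[nu]_i Pt t i A)%E = nu A.

(** * Real random variables *)

Definition has_density (R : realType) (d : measure_display)
    (T : measurableType d) (P : probability T R) (Y : {RV P >-> R})
    (f : R -> R) : Prop :=
  forall A : set R, measurable A ->
    distribution P Y A = (\int[lebesgue_measure]_(x in A) (f x)%:E)%E.

Definition Lip1 (R : realType) : set (R -> R) := [set h | 1.-lipschitz h].

(* The random variables may live on different probability spaces.  An
   ill-defined difference of two infinite expectations counts as infinite,
   since [|+oo - +oo| = +oo] in [\bar R]. *)
Definition wasserstein (R : realType) (d d' : measure_display)
    (T : measurableType d) (T' : measurableType d')
    (P : probability T R) (P' : probability T' R)
    (U : T -> R) (V : T' -> R) : \bar R :=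
  ereal_sup [set `| 'E_P[h \o U] - 'E_P'[h \o V] |%E | h in @Lip1 R].

(* The integral from [a] to [b], with the usual sign when [b < a]. *)
Definition oriented_integral (R : realType) (a b : R) (f : R -> R) : R :=
  if a <= b then \int[lebesgue_measure]_(y in `[a, b]) f y
  else - \int[lebesgue_measure]_(y in `[b, a]) f y.

(** * The Erlang-A system *)

Section ErlangA.
Variables (R : realType) (n : nat) (lambda mu alpha : R).

Definition erlangA_birth (k : nat) : R := lambda.

(* [(k - n)%N] is truncated subtraction, i.e. the positive part. *)
Definition erlangA_death (k : nat) : R :=
  mu * (minn k n)%:R + alpha * (k - n)%N%:R.

Definition erlangA (Pt : R -> R.-pker nat ~> nat) : Prop :=
  birth_death_process erlangA_birth erlangA_death Pt.

Definition offered_load : R := lambda / mu.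

Definition delta : R := 1 / Num.sqrt offered_load.

(* the equilibrium of the fluid model *)
Definition x_infty : R :=
  if n%:R <= offered_load then n%:R + (lambda - n%:R * mu) / alpha
  else offered_load.

Definition scaled_count (k : nat) : R := delta * (k%:R - x_infty).

Definition zeta : R := delta * (x_infty - n%:R).

Definition pos_part (x : R) : R := Num.max x 0.
Definition neg_part (x : R) : R := Num.max (- x) 0.

Definition drift (x : R) : R :=
  (neg_part (x + zeta) - neg_part zeta) * mu
  - (pos_part (x + zeta) - pos_part zeta) * alpha.

Definition unnormalized_density (x : R) : R :=
  expR (mu^-1 * oriented_integral 0 x drift).

Definition kappa : R :=
  (\int[lebesgue_measure]_x unnormalized_density x)^-1.

Definition diffusion_density (x : R) : R := kappa * unnormalized_density x.

End ErlangA.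

(* Main.v *)
From HB Require Import structures.
Require Import Defs.
From mathcomp Require Import all_boot all_order all_algebra.
From mathcomp Require Import all_classical all_reals all_analysis.
From mathcomp Require Import measurable_realfun ring lra.

Set Implicit Arguments.
Unset Strict Implicit.
Unset Printing Implicit Defensive.

Import Order.TTheory GRing.Theory Num.Theory.
Import numFieldNormedType.Exports.

Local Open Scope classical_set_scope.
Local Open Scope ring_scope.

(** The distance to be bounded is that of two explicit laws.  The stationary law of
    the chain satisfies detailed balance, [lambda pi_(k-1) = d_k pi_k], where
    [d_k] is the death rate (lemma [detailed_balance]).  Move the kink of the drift
    to the origin: the chain becomes [V = delta (X - n)], a lattice variable with
    step [delta], and the diffusion becomes a variable [W] with density
    proportional to [exp (- potential)].  The derivative [U] of the potential is
    increasing, with slope [c = alpha / mu] on the right of the kink and [1] on the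
    left of it, and [d_k / lambda = 1 + delta U (delta (k - n))]
    (lemma [rate_erlangA]).

    Since [1 + y <= exp y], the ratios of consecutive stationary probabilities
    dominate the ratios of the masses of consecutive lattice cells under [W].  So
    the two laws are ordered by likelihood ratio up to a shift by two cells, and
    [V + 2 delta] dominates [W] stochastically, unconditionally and also
    conditionally on either side of the kink (lemmas [stochastic_order],
    [mean_above_order] and [mean_below_order]).  For a 1-Lipschitz [h] the functions
    [t + h t] and [t - h t] are nondecreasing, and therefore
    [|E h V - E h W| <= E V - E W + 4 delta]: only the means need to be compared.

    Let [A] and [B] be the means of the positive and of the negative part of [V],
    and [A'], [B'] those of [W].  Stein's identities for the two laws, tested with
    constants on each side of the kink, give [c A - B = c A' - B' = - U 0], so that
    [E V - E W = (1 - c) (A - A')].  The order gives [A' <= A + 2 delta].  The upper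
    bound on [A - A'] has to be uniform as [c] tends to [0], where the two laws may
    spread out without limit.  It combines three facts.  The conditional means
    of [V] given that it is above the kink, and given that it is not, are smaller
    than those of [W] by at most two steps.  The convexity of the tail mass of the
    Gaussian as a function of its slope, inserted into Stein's identity of the
    chain, shows that the first of these conditional means is larger than that of
    [W] by at most one step (lemma [hazard_le]).  Finally
    [P (W < 0) P (W >= 0)] is at most a constant times the density of [W] at the
    kink.  A surplus [P (V > 0) - P (W > 0)] of mass above the kink would change the
    balance [c A - B]; so it is small, and it costs only a bounded number of
    steps (lemma [overshoot_bound]). *)

(** * Integrals of Gaussian tails *)

Section HalfLine.
Context {R : realType}.
Notation leb := (@lebesgue_measure R).
Notation half := (`[0%R, +oo[%classic : set R).

Lemma ge0_half_line_FTC (f F : R -> R) :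
  (forall t, 0 <= t -> 0 <= f t) -> continuous f ->
  (forall t, is_derive t (1 : R) F (f t)) -> F t @[t --> +oo] --> (0 : R) ->
  (\int[leb]_(t in half) (f t)%:E = (- F 0)%:E)%E.
Proof.
move=> f0 cf dF Foo.
have cF : continuous F.
  by move=> x; apply/differentiable_continuous/derivable1_diffP; apply: ex_derive.
rewrite (@ge0_continuous_FTC2y _ _ F _ 0) //.
- by rewrite -EFinB sub0r.
- exact: continuous_subspaceT.
- by apply: cvg_at_right_filter; exact: cF.
- by move=> x _; rewrite derive1E derive_val.
Qed.

Lemma half_line_integrable (f : R -> R) C : continuous f ->
  (forall t, 0 <= t -> `|f t| <= C * expR (- t)) ->
  leb.-integrable half (EFin \o f).
Proof.
move=> cf fC.
have mf (g : R -> R) :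
    continuous g -> measurable_fun (half : set (measurableTypeR R)) g.
  by move=> cg; apply/measurable_funTS; exact: continuous_measurable_fun.
have cE : continuous (fun t : R => C * expR (- t)).
  move=> x; apply: cvgM; first exact: cvg_cst.
  by apply: continuous_comp; [exact: continuousN|exact: continuous_expR].
have C0 t : 0 <= t -> 0 <= C * expR (- t).
  by move=> t0; exact: le_trans (fC _ t0).
apply: (@le_integrable _ _ _ leb half _ _
  (EFin \o (fun t : R => C * expR (- t)))) => //.
- by apply/measurable_EFinP; exact: mf.
- move=> t /=; rewrite in_itv/= andbT => t0; rewrite lee_fin.
  by rewrite (le_trans (fC _ t0)) // ler_norm.
- apply/integrableP; split; first by apply/measurable_EFinP; exact: mf.
  under eq_integral => t.
    rewrite inE/= in_itv/= andbT => t0; rewrite ger0_norm; last exact: C0.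
    over.
  have dE t : is_derive t (1 : R) (fun t => - (C * expR (- t))) (C * expR (- t)).
    by apply: is_derive_eq; rewrite -[1]/(1 : R) /GRing.scale/=; ring.
  have Eoo : - (C * expR (- t)) @[t --> +oo] --> (0 : R).
    rewrite -oppr0; apply: cvgN; rewrite -(mulr0 C).
    by apply: cvgM; [exact: cvg_cst|exact: cvgr_expR].
  by rewrite (ge0_half_line_FTC C0 cE dE Eoo) ltry.
Qed.

(** The integrand may change sign; adding the bound [C * expR (- t)], whose
    integral is known, reduces to a nonnegative one. *)
Lemma half_line_FTC (f F : R -> R) C : continuous f ->
  (forall t, 0 <= t -> `|f t| <= C * expR (- t)) ->
  (forall t, is_derive t (1 : R) F (f t)) -> F t @[t --> +oo] --> (0 : R) ->
  \int[leb]_(t in half) f t = - F 0.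
Proof.
move=> cf fC dF Foo.
have cE : continuous (fun t : R => C * expR (- t)).
  move=> x; apply: cvgM; first exact: cvg_cst.
  by apply: continuous_comp; [exact: continuousN|exact: continuous_expR].
have C0 t : 0 <= t -> 0 <= C * expR (- t).
  by move=> t0; exact: le_trans (fC _ t0).
have dE t : is_derive t (1 : R) (fun t => - (C * expR (- t))) (C * expR (- t)).
  by apply: is_derive_eq; rewrite -[1]/(1 : R) /GRing.scale/=; ring.
have Eoo : - (C * expR (- t)) @[t --> +oo] --> (0 : R).
  rewrite -oppr0; apply: cvgN; rewrite -(mulr0 C).
  by apply: cvgM; [exact: cvg_cst|exact: cvgr_expR].
have intE : \int[leb]_(t in half) (C * expR (- t)) = C.
  by rewrite /Rintegral (ge0_half_line_FTC C0 cE dE Eoo) /= oppr0 expR0 opprK mulr1.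
have : \int[leb]_(t in half) (f t + C * expR (- t)) = - F 0 + C.
  rewrite /Rintegral (@ge0_half_line_FTC _ (fun t => F t - C * expR (- t))) /=.
  - by rewrite oppr0 expR0; ring.
  - move=> t t0; have := fC _ t0; rewrite ler_norml => /andP[h _]; lra.
  - by move=> x; apply: cvgD; [exact: cf|exact: cE].
  - by rewrite -(addr0 0); apply: cvgD.
rewrite RintegralD //; last 2 first.
- exact: half_line_integrable fC.
- by apply: (@half_line_integrable _ C) => // t t0; rewrite ger0_norm // C0.
by rewrite intE => /addIr.
Qed.

(** Up to a constant factor the density of the diffusion limit, read away from the
    kink on either of its sides, is such a function. *)
Definition gauss_tail (b c t : R) : R := expR (- (b * t + c / 2 * t ^+ 2)).

Definition tail_moment (j : nat) (b c : R) : R :=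
  \int[leb]_(t in half) (t ^+ j * gauss_tail b c t).

Lemma gauss_tail_gt0 b c t : 0 < gauss_tail b c t.
Proof. exact: expR_gt0. Qed.

Lemma is_derive_gauss_tail b c t :
  is_derive t (1 : R) (gauss_tail b c) (- (b + c * t) * gauss_tail b c t).
Proof.
apply: is_derive_eq.
rewrite -[1]/(1 : R) /GRing.scale/= /gauss_tail.
have -> : - (b + c * t) * expR (- (b * t + c / 2 * t ^+ 2)) =
  expR (- (b * t + c / 2 * t ^+ 2)) * - (b + c * t) by rewrite mulrC.
by congr (_ * _); field.
Qed.

Lemma gauss_tail_decay b c : 0 < c ->
  exists C, 0 <= C /\ forall t, 0 <= t ->
    (1 + t + t ^+ 2) * gauss_tail b c t <= C * expR (- t).
Proof.
move=> c0; exists (3 * expR ((2 - b) ^+ 2 / (2 * c))); split.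
  by rewrite mulr_ge0 ?expR_ge0.
move=> t t0.
have h1 : 1 + t + t ^+ 2 <= 3 * expR t.
  have := expR_ge1Dxn 1 t0; have := expR_ge1Dx t.
  by rewrite (_ : (2`!)%:R = 2 :> R) //; lra.
apply: (@le_trans _ _ (3 * expR t * gauss_tail b c t)).
  by rewrite ler_pM2r ?gauss_tail_gt0.
rewrite /gauss_tail -!mulrA -!expRD ler_pM2l // ler_expR.
(* completing the square in [t - b * t - c / 2 * t ^ 2 <= const - t] *)
have : 0 <= (c * t - (2 - b)) ^+ 2 / (2 * c).
  by rewrite mulr_ge0 ?sqr_ge0 ?invr_ge0 ?mulr_ge0 ?(ltW c0).
have -> : (c * t - (2 - b)) ^+ 2 / (2 * c) =
   c / 2 * t ^+ 2 - (2 - b) * t + (2 - b) ^+ 2 / (2 * c).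
  by field; rewrite gt_eqF.
lra.
Qed.

Lemma continuous_gauss_tail b c : continuous (gauss_tail b c).
Proof.
move=> x; apply/differentiable_continuous/derivable1_diffP.
by have := is_derive_gauss_tail b c x => -[].
Qed.

Lemma poly2_gauss_tail_decay b c p q r : 0 < c ->
  exists C, forall t, 0 <= t ->
    `|(p + q * t + r * t ^+ 2) * gauss_tail b c t| <= C * expR (- t).
Proof.
move=> c0; have [C [C0 hC]] := gauss_tail_decay b c0.
exists ((`|p| + `|q| + `|r|) * C) => t t0.
rewrite normrM (gtr0_norm (gauss_tail_gt0 _ _ _)) -mulrA.
apply: (@le_trans _ _
  ((`|p| + `|q| + `|r|) * ((1 + t + t ^+ 2) * gauss_tail b c t))); last first.
  by apply: ler_wpM2l (hC t t0); rewrite !addr_ge0.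
rewrite [leRHS]mulrA ler_pM2r ?gauss_tail_gt0 //.
have := ler_normD (p + q * t) (r * t ^+ 2); have := ler_normD p (q * t).
rewrite !normrM (ger0_norm t0).
have := normr_ge0 p; have := normr_ge0 q; have := normr_ge0 r; have := sqr_ge0 t.
set P := `|p|; set Q := `|q|; set S := `|r| => t2 S0 Q0 P0.
have := mulr_ge0 P0 t0; have := mulr_ge0 P0 t2.
have := mulr_ge0 Q0 t2; have := mulr_ge0 S0 t0.
by lra.
Qed.

Lemma continuous_poly2_gauss_tail b c p q r :
  continuous (fun t : R => (p + q * t + r * t ^+ 2) * gauss_tail b c t).
Proof.
move=> x; apply: cvgM; last exact: continuous_gauss_tail.
apply: cvgD; last by apply: cvgM; [exact: cvg_cst|exact: exprn_continuous].
by apply: cvgD; [exact: cvg_cst|apply: cvgM; [exact: cvg_cst|exact: cvg_id]].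
Qed.

Lemma poly2_gauss_tail_cvg b c p q r : 0 < c ->
  (p + q * t + r * t ^+ 2) * gauss_tail b c t @[t --> +oo] --> (0 : R).
Proof.
move=> c0; have [C hC] := poly2_gauss_tail_decay b p q r c0.
apply/norm_cvg0P.
apply: (@squeeze_cvgr _ _ _ _ (fun=> 0) (fun t => C * expR (- t))).
- apply: filterS (nbhs_pinfty_ge (num_real (0 : R))) => t t0.
  by rewrite normr_ge0 /= hC.
- exact: cvg_cst.
- by rewrite -(mulr0 C); apply: cvgM; [exact: cvg_cst|exact: cvgr_expR].
Qed.

Lemma integrable_poly2_gauss_tail b c p q r : 0 < c ->
  leb.-integrable half (EFin \o (fun t => (p + q * t + r * t ^+ 2) * gauss_tail b c t)).
Proof.
move=> c0; have [C hC] := poly2_gauss_tail_decay b p q r c0.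
exact: (half_line_integrable (@continuous_poly2_gauss_tail b c p q r) hC).
Qed.

Lemma integral_poly2_gauss_tail b c p q r : 0 < c ->
  \int[leb]_(t in half) ((p + q * t + r * t ^+ 2) * gauss_tail b c t) =
  p * tail_moment 0 b c + q * tail_moment 1 b c + r * tail_moment 2 b c.
Proof.
move=> c0.
have i0 := integrable_poly2_gauss_tail b 1 0 0 c0.
have i1 := integrable_poly2_gauss_tail b 0 1 0 c0.
have i2 := integrable_poly2_gauss_tail b 0 0 1 c0.
have j0 := integrable_poly2_gauss_tail b p 0 0 c0.
have j1 := integrable_poly2_gauss_tail b 0 q 0 c0.
have j2 := integrable_poly2_gauss_tail b 0 0 r c0.
have j01 := integrable_poly2_gauss_tail b p q 0 c0.
transitivity (\int[leb]_(t in half) ((p + q * t + 0 * t ^+ 2) * gauss_tail b c t +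
   (0 + 0 * t + r * t ^+ 2) * gauss_tail b c t)).
  by apply: eq_Rintegral => t _; ring.
rewrite RintegralD //.
transitivity (\int[leb]_(t in half) ((p + 0 * t + 0 * t ^+ 2) * gauss_tail b c t +
   (0 + q * t + 0 * t ^+ 2) * gauss_tail b c t) + 
 \int[leb]_(t in half) ((0 + 0 * t + r * t ^+ 2) * gauss_tail b c t)).
  by congr (_ + _); apply: eq_Rintegral => t _; ring.
rewrite RintegralD //; congr (_ + _ + _).
- rewrite /tail_moment -RintegralZl //.
    by apply: eq_Rintegral => t _; ring.
  by apply: eq_integrable i0 => // t _ /=; congr EFin; ring.
- rewrite /tail_moment -RintegralZl //.
    by apply: eq_Rintegral => t _; ring.
  by apply: eq_integrable i1 => // t _ /=; congr EFin; ring.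
- rewrite /tail_moment -RintegralZl //.
    by apply: eq_Rintegral => t _; ring.
  by apply: eq_integrable i2 => // t _ /=; congr EFin; ring.
Qed.

(** Integrate [gauss_tail' = - (b + c t) gauss_tail]. *)
Lemma tail_moment01 b c : 0 < c ->
  b * tail_moment 0 b c + c * tail_moment 1 b c = 1.
Proof.
move=> c0; have := integral_poly2_gauss_tail b b c 0 c0.
rewrite mul0r addr0 => <-.
have [C hC] := poly2_gauss_tail_decay b b c 0 c0.
have dF t : is_derive t (1 : R) (fun t => - gauss_tail b c t)
    ((b + c * t + 0 * t ^+ 2) * gauss_tail b c t).
  by have h := is_derive_gauss_tail b c t; apply: is_derive_eq; ring.
have Foo : - gauss_tail b c t @[t --> +oo] --> (0 : R).
  rewrite -oppr0; apply: cvgN.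
  have := poly2_gauss_tail_cvg b 1 0 0 c0.
  by under eq_fun do rewrite !mul0r !addr0 mul1r.
rewrite (half_line_FTC (@continuous_poly2_gauss_tail _ _ _ _ _) hC dF Foo).
by rewrite /gauss_tail !(mulr0,expr0n) /= ?mulr0 addr0 oppr0 expR0 opprK.
Qed.

(** Integrate the derivative of [t * gauss_tail b c t]. *)
Lemma tail_moment12 b c : 0 < c ->
  b * tail_moment 1 b c + c * tail_moment 2 b c = tail_moment 0 b c.
Proof.
move=> c0; have := integral_poly2_gauss_tail b (-1) b c c0.
have [C hC] := poly2_gauss_tail_decay b (-1) b c c0.
have dF t : is_derive t (1 : R) (fun t => - (t * gauss_tail b c t))
    ((-1 + b * t + c * t ^+ 2) * gauss_tail b c t).
  have h := is_derive_gauss_tail b c t.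
  by apply: is_derive_eq; rewrite -[1]/(1 : R) /GRing.scale/=; ring.
have Foo : - (t * gauss_tail b c t) @[t --> +oo] --> (0 : R).
  rewrite -oppr0; apply: cvgN.
  have := poly2_gauss_tail_cvg b 0 1 0 c0.
  by under eq_fun do rewrite !mul0r add0r addr0 mul1r.
rewrite (half_line_FTC (@continuous_poly2_gauss_tail _ _ _ _ _) hC dF Foo).
by rewrite mul0r !oppr0; lra.
Qed.

Lemma tail_moment_ge0 j b c : 0 <= tail_moment j b c.
Proof.
apply: Rintegral_ge0 => t /=; rewrite in_itv/= andbT => t0.
by rewrite mulr_ge0 ?exprn_ge0 // ltW // gauss_tail_gt0.
Qed.

Lemma tail_quadratic_ge0 b c s : 0 < c ->
  0 <= s ^+ 2 * tail_moment 0 b c - 2 * s * tail_moment 1 b c + tail_moment 2 b c.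
Proof.
move=> c0.
have <- : \int[leb]_(t in half)
     ((s ^+ 2 + (- (2 * s)) * t + 1 * t ^+ 2) * gauss_tail b c t) =
   s ^+ 2 * tail_moment 0 b c - 2 * s * tail_moment 1 b c + tail_moment 2 b c.
  by rewrite integral_poly2_gauss_tail //; ring.
apply: Rintegral_ge0 => t _; apply: mulr_ge0; last exact: ltW (gauss_tail_gt0 _ _ _).
by have -> : s ^+ 2 + (- (2 * s)) * t + 1 * t ^+ 2 = (s - t) ^+ 2;
  [ring|exact: sqr_ge0].
Qed.

Lemma tail_moment0_gt0 b c : 0 < c -> 0 < tail_moment 0 b c.
Proof.
move=> c0; rewrite lt_neqAle tail_moment_ge0 andbT eq_sym; apply/eqP => M0.
have := tail_moment01 b c0; rewrite M0 mulr0 add0r => cN.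
have N0 : 0 < tail_moment 1 b c.
  by have := @ltr01 R; rewrite -cN pmulr_rgt0.
(* the second moment about a point far to the right would be negative *)
have := tail_quadratic_ge0 b ((tail_moment 2 b c + 1) / tail_moment 1 b c) c0.
have -> : 2 * ((tail_moment 2 b c + 1) / tail_moment 1 b c) * tail_moment 1 b c =
  2 * (tail_moment 2 b c + 1) by field; rewrite gt_eqF.
by rewrite M0 mulr0 add0r; have := tail_moment_ge0 2 b c; lra.
Qed.

(** Cauchy-Schwarz for the three moments, fed into the two identities between
    them.  It expresses the log-concavity of [gauss_tail b c]: an exponential
    tail would give equality. *)
Lemma tail_moment1_le b c : 0 < c -> tail_moment 1 b c <= tail_moment 0 b c ^+ 2.
Proof.
move=> c0; have M0 := tail_moment0_gt0 b c0.
have := tail_quadratic_ge0 b (tail_moment 1 b c / tail_moment 0 b c) c0.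
have := tail_moment01 b c0; have := tail_moment12 b c0.
set M := tail_moment 0 b c in M0 *; set N := tail_moment 1 b c.
set S := tail_moment 2 b c.
move=> eM e1 h.
have {}h : N ^+ 2 <= M * S.
  rewrite -subr_ge0; have -> : M * S - N ^+ 2 =
    M * ((N / M) ^+ 2 * M - 2 * (N / M) * N + S) by field; rewrite gt_eqF.
  by rewrite mulr_ge0 // ltW.
have -> : N = N * (b * M + c * N) by rewrite e1 mulr1.
have -> : M ^+ 2 = M * (b * N + c * S) by rewrite eM.
have : c * N ^+ 2 <= c * (M * S) by rewrite ler_pM2l.
by lra.
Qed.

(** The mass is a convex function of [b], with derivative [- tail_moment 1 b c],
    and so lies above its tangents; [tail_moment01] eliminates the first moment.
    With [b] the restoring force at a state of the chain, [1 + d * b] is the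
    ratio of the death rate to the birth rate there and [b + c * d] is the
    restoring force one state higher. *)
Lemma tail_moment0_convex b c d : 0 < c -> 0 <= d ->
  (1 + d * b) * tail_moment 0 b c - d <= tail_moment 0 (b + c * d) c.
Proof.
move=> c0 d0.
have -> : (1 + d * b) * tail_moment 0 b c - d =
   1 * tail_moment 0 b c + (- (c * d)) * tail_moment 1 b c + 0 * tail_moment 2 b c.
  by rewrite -[X in _ - X]mulr1 -(tail_moment01 b c0); ring.
have -> : tail_moment 0 (b + c * d) c =
  1 * tail_moment 0 (b + c * d) c + 0 * tail_moment 1 (b + c * d) c +
  0 * tail_moment 2 (b + c * d) c by ring.
rewrite -!integral_poly2_gauss_tail //.
apply: le_Rintegral => //; [exact: integrable_poly2_gauss_tail..|].
move=> t _; rewrite !mul0r !addr0 mul1r.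
have -> : gauss_tail (b + c * d) c t = expR (- (c * d * t)) * gauss_tail b c t.
  by rewrite /gauss_tail -expRD; congr expR; ring.
rewrite ler_pM2r ?gauss_tail_gt0 //.
by have := expR_ge1Dx (- (c * d * t)); lra.
Qed.

Lemma tail_moment0_decr b c d : 0 < c -> 0 <= d ->
  tail_moment 0 (b + d) c <= tail_moment 0 b c.
Proof.
move=> c0 d0.
have e b' : tail_moment 0 b' c =
  1 * tail_moment 0 b' c + 0 * tail_moment 1 b' c + 0 * tail_moment 2 b' c by ring.
rewrite (e b) (e (b + d)) -!integral_poly2_gauss_tail //.
apply: le_Rintegral => //; [exact: integrable_poly2_gauss_tail..|].
move=> t /=; rewrite in_itv/= andbT => t0; rewrite !mul0r !addr0 !mul1r ler_expR.
by have := mulr_ge0 d0 t0; lra.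
Qed.

(** The inequality [1 - 2 t / 3 <= exp (2 - 2 t) / 3] bounds the mass by
    the first moment, which is at most [1 + tail_moment 0 b 1], and by the mass
    of the tilted tail with parameter [b + 2 >= 1], which is at most [1]. *)
Lemma tail_moment0_bound b : -1 <= b -> tail_moment 0 b 1 <= expR 2 + 2.
Proof.
move=> b1; have o1 := @ltr01 R.
have M2 : tail_moment 0 (b + 2) 1 <= 1.
  have := tail_moment01 (b + 2) o1.
  have := tail_moment_ge0 1 (b + 2) 1; have := tail_moment_ge0 0 (b + 2) 1.
  set M := tail_moment 0 _ _ => M0 N0 e.
  have : 0 <= (b + 1) * M by rewrite mulr_ge0 //; lra.
  by lra.
have N1 : tail_moment 1 b 1 <= 1 + tail_moment 0 b 1.
  have := tail_moment01 b o1; have := tail_moment_ge0 0 b 1.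
  set M := tail_moment 0 _ _ => M0 e.
  have : 0 <= (b + 1) * M by rewrite mulr_ge0 //; lra.
  by lra.
have h : tail_moment 0 b 1 - 2 / 3 * tail_moment 1 b 1 <=
         expR 2 / 3 * tail_moment 0 (b + 2) 1.
  have -> : tail_moment 0 b 1 - 2 / 3 * tail_moment 1 b 1 =
     1 * tail_moment 0 b 1 + - (2 / 3) * tail_moment 1 b 1 +
     0 * tail_moment 2 b 1 by ring.
  have -> : expR 2 / 3 * tail_moment 0 (b + 2) 1 = expR 2 / 3 * tail_moment 0 (b + 2) 1
     + 0 * tail_moment 1 (b + 2) 1 + 0 * tail_moment 2 (b + 2) 1 by ring.
  rewrite -!integral_poly2_gauss_tail //.
  apply: le_Rintegral => //; [exact: integrable_poly2_gauss_tail..|].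
  move=> t _; rewrite !mul0r !addr0.
  have -> : expR 2 / 3 * gauss_tail (b + 2) 1 t =
      expR (2 - 2 * t) / 3 * gauss_tail b 1 t.
    rewrite /gauss_tail mulrAC -expRD [in RHS]mulrAC -expRD.
    by congr (expR _ / 3); ring.
  rewrite ler_pM2r ?gauss_tail_gt0 //.
  by have := expR_ge1Dx (2 - 2 * t); lra.
have : expR 2 / 3 * tail_moment 0 (b + 2) 1 <= expR 2 / 3 * 1.
  by rewrite ler_pM2l // divr_gt0 ?expR_gt0.
by lra.
Qed.
End HalfLine.

(** * Laws on the line with a density *)

Section Density.
Context {R : realType}.
Notation leb := (@lebesgue_measure R).
Notation Rm := (measurableTypeR R).

Lemma measurable_addr (a : R) : measurable_fun [set: Rm] (fun x : Rm => (x + a : Rm)).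
Proof. by apply: measurable_funD. Qed.

Lemma lebesgue_measure_shift (a : R) (A : set R) : measurable (A : set Rm) ->
  pushforward leb (fun x : Rm => (x + a : Rm)) A = leb A.
Proof.
move=> mA.
pose s : {mfun Rm >-> Rm} := HB.pack (fun x : Rm => (x + a : Rm))
  (@isMeasurableFun.Build _ _ _ _ _ (measurable_addr a)).
apply/esym/(@lebesgue_measure_unique R (pushforward leb s)) => // _ [[x y] _ <-] /=.
rewrite /pushforward.
have -> : s @^-1` `]x, y] = `]x - a, y - a]%classic.
  apply/seteqP; split => z /=; rewrite !in_itv/= ltrBlDr lerBrDr //.
rewrite !lebesgue_measure_itv /= !lte_fin ltrD2r.
by case: ifPn => // _; rewrite -!EFinB; congr EFin; ring.
Qed.

Definition is_density (w : set R -> \bar R) (f : R -> R) :=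
  forall A : set R, measurable (A : set Rm) ->
  w A = (\int[leb]_(x in A) (f x)%:E)%E.

Variable w : probability Rm R.

(** Both [f] and the Radon-Nikodym derivative are densities of [w], so they agree
    almost everywhere. *)
Lemma density_integral (f : R -> R) (g : R -> \bar R) (D : set R) :
  is_density w f -> (forall x, 0 <= f x) -> measurable_fun [set: Rm] f ->
  (forall x, 0 <= g x)%E -> measurable_fun [set: Rm] g -> measurable (D : set Rm) ->
  (\int[w]_(x in D) g x = \int[leb]_(x in D) (g x * (f x)%:E))%E.
Proof.
move=> wf f0 mf g0 mg mD.
have wleb : w `<< leb.
  apply/null_content_dominatesP => A mA A0; rewrite wf //.
  apply: null_set_integral => //.
  by apply/measurable_EFinP; exact: measurable_funTS.
rewrite -(Radon_Nikodym_SigmaFinite.change_of_variables wleb) //; last first.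
  exact: measurable_funTS.
have iRN := Radon_Nikodym_SigmaFinite.f_integrable wleb.
have mRN := measurable_int _ iRN.
apply: ge0_ae_eq_integral => //.
- by apply: emeasurable_funM; apply: measurable_funTS.
- by apply: emeasurable_funM; apply: measurable_funTS => //; apply/measurable_EFinP.
- by move=> x _; apply: mule_ge0 => //; exact: Radon_Nikodym_SigmaFinite.f_ge0.
- by move=> x _; apply: mule_ge0 => //; rewrite lee_fin.
- apply: ae_eqe_mul2l.
  apply: integral_ae_eq => //.
  + exact: integrableS iRN.
  + by apply/measurable_EFinP; exact: measurable_funTS.
  + move=> E _ mE.
    by rewrite -Radon_Nikodym_SigmaFinite.f_integral //; exact: wf.
Qed.

Lemma density_pushforward (f : R -> R) (s : {mfun Rm >-> Rm}) (s' : R -> R) :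
  is_density w f -> (forall x, 0 <= f x) ->
  measurable_fun [set: Rm] (f \o s') -> cancel s s' ->
  (forall A : set R, measurable (A : set Rm) -> pushforward leb s A = leb A) ->
  is_density (distribution w s) (f \o s').
Proof.
move=> wf f0 mf sK spush A mA.
have mpA : measurable (s @^-1` A).
  by rewrite -[X in measurable X]setTI; exact: measurable_funP.
rewrite /distribution/= /pushforward wf //.
rewrite [RHS](eq_measure_integral (pushforward leb s)) //; last first.
  by move=> B mB _; apply: esym; exact: spush.
rewrite ge0_integral_pushforward //.
- by apply: eq_integral => x _ /=; rewrite sK.
- by apply/measurable_EFinP; exact: measurable_funTS.
- by move=> x _; rewrite lee_fin /=.
Qed.

Notation half := (`[0%R, +oo[%classic : set R).

Lemma half_line_density (f : R -> R) k b c :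
  is_density w f -> (forall x, 0 <= f x) -> measurable_fun [set: Rm] f ->
  0 < c -> (forall t, 0 <= t -> f t = k * gauss_tail b c t) ->
  w half = (k * tail_moment 0 b c)%:E /\
  (\int[w]_(t in half) t%:E)%E = (k * tail_moment 1 b c)%:E.
Proof.
move=> wf f0 mf c0 fE.
have mom p q : (\int[leb]_(t in half)
      (k * ((p + q * t + 0 * t ^+ 2) * gauss_tail b c t))%:E)%E =
    (k * (p * tail_moment 0 b c + q * tail_moment 1 b c))%:E.
  have ig := integrable_poly2_gauss_tail b p q 0 c0.
  have := integral_poly2_gauss_tail b p q 0 c0; rewrite mul0r addr0 => <-.
  rewrite -RintegralZl // /Rintegral fineK //; apply: integrable_fin_num => //.
  exact: (integrableZl _ k ig).
split.
- rewrite wf //.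
  have := mom 1 0; rewrite mul1r mul0r addr0 => <-.
  apply: eq_integral => t; rewrite inE/= in_itv/= andbT => t0.
  by rewrite fE //; congr EFin; ring.
- have := mom 0 1; rewrite mul1r mul0r add0r => <-.
  transitivity (\int[w]_(t in half) (Num.max t 0)%:E)%E.
    apply: eq_integral => t; rewrite inE/= in_itv/= andbT => t0.
    by rewrite /Num.max ltNge t0.
  rewrite (density_integral wf) //.
  + apply: eq_integral => t; rewrite inE/= in_itv/= andbT => t0.
    rewrite fE // -EFinM; congr EFin.
    by rewrite /Num.max ltNge t0 /=; ring.
  + by move=> t; rewrite lee_fin le_max lexx orbT.
  + by apply/measurable_EFinP; apply: measurable_maxr.
Qed.
End Density.

(** * Laws on the nonnegative integers *)

Section NatLaw.
Context {R : realType}.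
Variable nu : probability nat R.

Definition mass (k : nat) : R := fine (nu [set k]).

Lemma mass_ge0 k : 0 <= mass k. Proof. exact: fine_ge0. Qed.

Lemma massE k : nu [set k] = (mass k)%:E.
Proof. by rewrite fineK // fin_num_measure. Qed.

Lemma ge0_integral_mass (g : nat -> R) : (forall k, 0 <= g k) ->
  (\int[nu]_k (g k)%:E = \sum_(0 <= k <oo) (g k * mass k)%:E)%E.
Proof.
move=> g0.
have -> : [set: nat] = \bigcup_k [set k].
  by apply/seteqP; split => k //= _; exists k.
rewrite ge0_integral_bigcup //.
- apply: eq_eseriesr => k _.
  rewrite (eq_integral (cst (g k)%:E)) => [|x /[1!inE] -> //].
  by rewrite integral_cst // EFinM; congr (_ * _)%E; exact: massE.
- by move=> k _; rewrite lee_fin.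
- by move=> i j _ _ [x [/= -> ->]].
Qed.

Lemma ge0_cvg_partial_sums (f : nat -> R) : (forall k, 0 <= f k) ->
  nu.-integrable setT (EFin \o f) ->
  \sum_(0 <= k < N) f k * mass k @[N --> \oo] --> \int[nu]_k f k.
Proof.
move=> f0 fi.
have fp k : (0 <= (f k * mass k)%:E)%E by rewrite lee_fin mulr_ge0 // mass_ge0.
have := @is_cvg_nneseries _ (fun k => (f k * mass k)%:E) xpredT 0 (fun k _ _ => fp k).
rewrite -ge0_integral_mass // -(fineK (integrable_fin_num _ fi)) // => /fine_cvg.
apply: cvg_trans; apply: near_eq_cvg; near=> N => /=.
by rewrite sumEFin.
Unshelve. all: by end_near. Qed.

Lemma cvg_partial_sums (f : nat -> R) : nu.-integrable setT (EFin \o f) ->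
  \sum_(0 <= k < N) f k * mass k @[N --> \oo] --> \int[nu]_k f k.
Proof.
move=> fi.
have fpi := integrable_funrpos measurableT fi.
have fni := integrable_funrneg measurableT fi.
have -> : \int[nu]_k f k = \int[nu]_k (f^\+)%R k - \int[nu]_k (f^\-)%R k.
  rewrite -RintegralB //; apply: eq_Rintegral => k _.
  by rewrite -[in LHS](funrposBneg f).
have -> : (fun N => \sum_(0 <= k < N) f k * mass k) =
    (fun N => \sum_(0 <= k < N) (f^\+)%R k * mass k -
              \sum_(0 <= k < N) (f^\-)%R k * mass k).
  apply/funext => N; rewrite -sumrB; apply: eq_bigr => k _.
  by rewrite -mulrBl -[in LHS](funrposBneg f).
by apply: cvgB; apply: ge0_cvg_partial_sums => // k; rewrite ?funrpos_ge0 ?funrneg_ge0.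
Qed.

(** The discrete Stein identity: with [a] the ratio of the death rates to the
    birth rate, the hypothesis on [mass] is the detailed balance of a birth-death
    chain. *)
Lemma mass_shift_integral (a f : nat -> R) :
  (forall k, 0 <= a k) -> a 0%N = 0 -> (forall k, a k.+1 * mass k.+1 = mass k) ->
  (forall k, 0 <= f k) ->
  (\int[nu]_k (a k * f k)%:E = \int[nu]_k (f k.+1)%:E)%E.
Proof.
move=> a0 a00 am f0.
rewrite (@ge0_integral_mass (fun k => a k * f k)); last by move=> k; exact: mulr_ge0.
rewrite (@ge0_integral_mass (fun k => f k.+1)); last by move=> k; exact: f0.
have fp k : (0 <= (a k * f k * mass k)%:E)%E.
  by rewrite lee_fin; apply: mulr_ge0; [exact: mulr_ge0|exact: mass_ge0].
rewrite nneseries_recl // a00 !mul0r add0e.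
rewrite -(@nneseries_addn _ (fun k => (a k * f k * mass k)%:E) 1) //.
by apply: eq_eseriesr => k _; rewrite addn1 mulrAC am mulrC.
Qed.
End NatLaw.

(** Chebyshev's sum inequality in the form that compares the averages of [phi] for
    two weights whose ratio [x / y] is monotone. *)
Lemma chebyshev_sum (R : realDomainType) (x y phi : nat -> R) N :
  (forall i j, (i < j)%N -> 0 <= (phi j - phi i) * (x j * y i - x i * y j)) ->
  (\sum_(0 <= k < N) phi k * y k) * (\sum_(0 <= k < N) x k) <=
  (\sum_(0 <= k < N) phi k * x k) * (\sum_(0 <= k < N) y k).
Proof.
move=> h; elim: N => [|N IH]; first by rewrite !big_geq // mulr0.
rewrite !big_nat_recr //= -subr_ge0.
set A := \sum_(_ <= _ < _) phi _ * x _ in IH *; set Y := \sum_(_ <= _ < _) y _ in IH *.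
set B := \sum_(_ <= _ < _) phi _ * y _ in IH *; set X := \sum_(_ <= _ < _) x _ in IH *.
have -> : (A + phi N * x N) * (Y + y N) - (B + phi N * y N) * (X + x N) =
  (A * Y - B * X) + (phi N * x N * Y + y N * A - phi N * y N * X - x N * B) by ring.
apply: addr_ge0; first by rewrite subr_ge0.
rewrite /A /B /X /Y !mulr_sumr -big_split /= -!sumrB big_nat.
apply: sumr_ge0 => i /andP[_ iN]; have := h _ _ iN.
by congr (0 <= _); ring.
Qed.

Section LikelihoodRatio.
Context {R : realType}.
Variables (nu rho : probability nat R) (I : pred nat) (phi : nat -> R).

(** Conditionally on [I], a law whose mass function has an increasing ratio to that
    of another law dominates the other law stochastically. *)
Lemma likelihood_ratio_order :
  nu.-integrable setT (EFin \o (fun k => phi k * (I k)%:R)) ->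
  rho.-integrable setT (EFin \o (fun k => phi k * (I k)%:R)) ->
  (forall i j, I i -> I j -> (i < j)%N -> phi i <= phi j) ->
  (forall i j, I i -> I j -> (i < j)%N ->
    mass nu i * mass rho j <= mass nu j * mass rho i) ->
  (\int[rho]_k (phi k * (I k)%:R)) * (\int[nu]_k (I k)%:R) <=
  (\int[nu]_k (phi k * (I k)%:R)) * (\int[rho]_k (I k)%:R).
Proof.
move=> inu irho phiI lr.
have iI (m : probability nat R) :
    m.-integrable setT (EFin \o (fun k : nat => (I k)%:R : R)).
  apply: (@le_integrable _ _ _ m setT _ _ (EFin \o cst 1)) => //.
  - move=> k _ /=; rewrite lee_fin normr1.
    by case: (I k); rewrite ?normr1 ?normr0 ?ler01.
  - exact: finite_measure_integrable_cst.
apply: (ler_cvg_to (cvgM (cvg_partial_sums irho) (cvg_partial_sums (iI nu)))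
  (cvgM (cvg_partial_sums inu) (cvg_partial_sums (iI rho)))).
apply: nearW => N /=.
have e (m : probability nat R) : \sum_(0 <= k < N) phi k * (I k)%:R * mass m k =
    \sum_(0 <= k < N) phi k * ((I k)%:R * mass m k).
  by apply: eq_bigr => k _; rewrite mulrA.
rewrite !e; apply: chebyshev_sum => i j ij.
case Ii : (I i); case Ij : (I j);
  rewrite ?(mul0r, mulr0, mul1r, subr0, sub0r, oppr0) //.
by rewrite mulr_ge0 ?subr_ge0 ?phiI // ?lr.
Qed.
End LikelihoodRatio.

(** * Detailed balance for stationary birth-death chains *)

(** The forward equations are not available as equalities on an infinite state
    space.  Keeping finitely many terms of the stationarity equation and
    differentiating at time [0] gives only inequalities, which for a birth-death
    chain say that the net probability flux across the edges [k, k + 1] is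
    nonnegative and nondecreasing in [k].  As it is at most [birth k] times the
    probability of [k], it tends to [0], and so it vanishes. *)
Section DetailedBalance.
Context {R : realType}.
Variables (Pt : R -> R.-pker nat ~> nat) (nu : probability nat R).
Hypothesis nuP : stationary Pt nu.

Lemma stationary_partial_sum_le t j N : 0 <= t ->
  \sum_(0 <= i < N) fine (Pt t i [set j]) * mass nu i <= mass nu j.
Proof.
move=> t0.
have fnum i : Pt t i [set j] \is a fin_num.
  rewrite ge0_fin_numE //; apply: (@le_lt_trans _ _ (Pt t i setT)); last first.
    by rewrite prob_kernel ltry.
  by apply: le_measure; rewrite ?inE.
have p0 i : 0 <= fine (Pt t i [set j]) by exact: fine_ge0.
rewrite -lee_fin -massE -(nuP _ t0) -sumEFin.
rewrite (eq_integral (fun i => (fine (Pt t i [set j]))%:E)); last first.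
  by move=> i _; rewrite fineK.
rewrite ge0_integral_mass //.
apply: nneseries_lim_ge => i _ _; rewrite lee_fin.
by apply: mulr_ge0 => //; exact: mass_ge0.
Qed.

Lemma stationary_rates_le (q : nat -> nat -> R) j N : has_rates Pt q -> (j < N)%N ->
  \sum_(0 <= i < N) q i j * mass nu i <= 0.
Proof.
move=> hq jN.
have h : \sum_(0 <= i < N) (fine (Pt t i [set j]) - (i == j)%:R) / t * mass nu i
    @[t --> 0^'+] --> \sum_(0 <= i < N) q i j * mass nu i.
  apply: cvg_big => [|i _]; first exact: add_continuous.
  by apply: cvgM; [exact: hq|exact: cvg_cst].
apply: (ler_cvg_to h (cvg_cst (0 : R))).
near=> t.
have t0 : 0 < t by near: t; exact: nbhs_right_gt.
rewrite (_ : \sum_(_ <= _ < _) _ =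
  t^-1 * (\sum_(0 <= i < N) fine (Pt t i [set j]) * mass nu i - mass nu j)).
  by rewrite pmulr_rle0 ?invr_gt0 // subr_le0 stationary_partial_sum_le // ltW.
have -> : mass nu j = \sum_(0 <= i < N) (i == j)%:R * mass nu i.
  rewrite (big_rem j) /=; last by rewrite mem_index_iota.
  rewrite eqxx mul1r big_seq big1 ?addr0 // => i.
  by rewrite mem_rem_uniq ?iota_uniq // !inE => /andP[/negPf -> _]; rewrite mul0r.
rewrite -sumrB mulr_sumr; apply: eq_bigr => i _; ring.
Unshelve. all: by end_near. Qed.

Lemma cvg_mass0 : mass nu k @[k --> \oo] --> (0 : R).
Proof.
have := @cvg_partial_sums _ nu (cst 1) (finite_measure_integrable_cst _ _ measurableT).
move=> /(cvgP _) h.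
have -> : (fun k => mass nu k) = (fun k => 1 * mass nu k).
  by apply/funext => k; rewrite mul1r.
exact: (cvg_series_cvg_0 h).
Qed.

Variables (birth death : nat -> R) (b : R).
Hypothesis birth_le : forall k, birth k <= b.
Hypothesis death_ge0 : forall k, 0 <= death k.
Hypothesis PtQ : has_rates Pt (birth_death_rates birth death).

Let flux k := birth k * mass nu k - death k.+1 * mass nu k.+1.

Lemma flux0_ge0 : 0 <= flux 0.
Proof.
have := @stationary_rates_le _ 0 2 PtQ isT.
by rewrite !big_nat_recr //= big_geq // /birth_death_rates /= /flux; lra.
Qed.

Lemma flux_nondecreasing k : flux k <= flux k.+1.
Proof.
have := @stationary_rates_le _ k.+1 k.+3 PtQ (leqnSn _).
rewrite !big_nat_recr //= big_nat big1 ?add0r; last first.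
  move=> i /andP[_ ik]; rewrite /birth_death_rates !eqSS.
  by rewrite (gtn_eqF ik) (ltn_eqF (leqW (leqW ik))) (ltn_eqF (leqW ik)) mul0r.
rewrite /birth_death_rates !eqxx !eqSS.
rewrite (ltn_eqF (ltnSn k)) (ltn_eqF (leqnSn k.+1)) /flux.
lra.
Qed.

Lemma detailed_balance k : birth k * mass nu k = death k.+1 * mass nu k.+1.
Proof.
have mono i j : (i <= j)%N -> flux i <= flux j.
  move=> /subnK <-; elim: (j - i)%N => // m IH.
  exact: le_trans IH (flux_nondecreasing _).
suff : flux k = 0 by move/eqP; rewrite subr_eq0 => /eqP.
apply/eqP; rewrite eq_le; apply/andP; split; last first.
  exact: le_trans flux0_ge0 (mono _ _ (leq0n k)).
have h : b * mass nu j @[j --> \oo] --> (0 : R).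
  by rewrite -(mulr0 b); apply: cvgM; [exact: cvg_cst|exact: cvg_mass0].
apply: (ler_cvg_to (cvg_cst (flux k)) h).
near=> j.
apply: (@le_trans _ _ (flux j)); first by apply: mono; near: j; exact: nbhs_infty_ge.
rewrite /flux lerBlDr (le_trans (ler_wpM2r (mass_ge0 nu j) (birth_le j))) //.
by rewrite lerDl mulr_ge0 // mass_ge0.
Unshelve. all: by end_near. Qed.
End DetailedBalance.

(** * A Gaussian potential with a kink *)

Section Diffusion.
Context {R : realType}.
Notation leb := (@lebesgue_measure R).
Notation Rm := (measurableTypeR R).
Notation half := (`[0%R, +oo[%classic : set R).
Variables (beta c : R).

(** With the kink moved to the origin and the density written as
    [exp (- potential)], this is the derivative of the potential. *)
Definition restoring (t : R) : R := beta + c * pos_part t - neg_part t.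

Definition two_sided_gauss (t : R) : R :=
  expR (- (beta * t + c / 2 * pos_part t ^+ 2 + neg_part t ^+ 2 / 2)).

Lemma pos_partE (t : R) : 0 <= t -> pos_part t = t /\ neg_part t = 0.
Proof.
move=> t0; rewrite /pos_part /neg_part; split; first exact: max_l.
by apply: max_r; rewrite oppr_le0.
Qed.

Lemma neg_partE (t : R) : t <= 0 -> pos_part t = 0 /\ neg_part t = - t.
Proof.
move=> t0; rewrite /pos_part /neg_part; split; first exact: max_r.
by apply: max_l; rewrite oppr_ge0.
Qed.

Lemma pos_part_ge0 (t : R) : 0 <= pos_part t.
Proof. by rewrite le_max lexx orbT. Qed.

Lemma neg_part_ge0 (t : R) : 0 <= neg_part t.
Proof. by rewrite le_max lexx orbT. Qed.

Lemma pos_partB (t : R) : pos_part t - neg_part t = t.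
Proof.
by case: (lerP 0 t) => [/pos_partE[-> ->]|/ltW/neg_partE[-> ->]]; ring.
Qed.

Lemma restoring_le : 0 <= c -> {homo restoring : x y / x <= y}.
Proof.
move=> c0 x y xy; rewrite /restoring.
have hp : pos_part x <= pos_part y by rewrite /pos_part ge_max !le_max xy lexx !orbT.
have hn : neg_part y <= neg_part x.
  by rewrite /neg_part ge_max !le_max lerN2 xy lexx !orbT.
have : c * pos_part x <= c * pos_part y by rewrite ler_wpM2l.
by lra.
Qed.

(** The potential is convex: its increment over [[t, t + d]] is at least [d]
    times its slope at any point [x] on the left. *)
Lemma two_sided_gauss_step (d x t : R) : 0 <= c -> 0 <= d -> x <= t ->
  two_sided_gauss (t + d) <= expR (- (d * restoring x)) * two_sided_gauss t.
Proof.
move=> c0 d0 xt; rewrite /two_sided_gauss -expRD ler_expR.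
have : d * restoring x <= d * restoring t by rewrite ler_wpM2l // restoring_le.
suff : d * restoring t <= beta * d + c / 2 * (pos_part (t + d) ^+ 2 - pos_part t ^+ 2)
    + (neg_part (t + d) ^+ 2 - neg_part t ^+ 2) / 2 by lra.
have hp : 2 * d * pos_part t <= pos_part (t + d) ^+ 2 - pos_part t ^+ 2.
  case: (lerP 0 t) => t0.
    have [-> _] := pos_partE t0; have [-> _] := pos_partE (addr_ge0 t0 d0).
    by have := sqr_ge0 d; lra.
  have [-> _] := neg_partE (ltW t0).
  by have := sqr_ge0 (pos_part (t + d)); lra.
have hn : - (2 * d * neg_part t) <= neg_part (t + d) ^+ 2 - neg_part t ^+ 2.
  case: (lerP 0 t) => t0.
    have [_ ->] := pos_partE t0; have [_ ->] := pos_partE (addr_ge0 t0 d0).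
    by lra.
  have [_ ->] := neg_partE (ltW t0).
  case: (lerP 0 (t + d)) => td.
    have [_ ->] := pos_partE td.
    have : 0 <= (t + d) * (d + d - t - d) by rewrite mulr_ge0 //; lra.
    by have := sqr_ge0 d; nra.
  by have [_ ->] := neg_partE (ltW td); have := sqr_ge0 d; lra.
have := ler_wpM2l c0 hp; rewrite /restoring; lra.
Qed.

Lemma measurable_pos_part : measurable_fun [set: Rm] (@pos_part R : Rm -> Rm).
Proof. by apply: measurable_maxr => //; exact: measurable_cst. Qed.

Lemma measurable_neg_part : measurable_fun [set: Rm] (@neg_part R : Rm -> Rm).
Proof. by apply: measurable_maxr => //; apply: measurable_funN. Qed.

Lemma measurable_two_sided_gauss :
  measurable_fun [set: Rm] (two_sided_gauss : Rm -> Rm).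
Proof.
apply: measurableT_comp; first exact: measurable_expR.
apply: measurable_funN; apply: measurable_funD.
  apply: measurable_funD; first exact: measurable_funM.
  apply: measurable_funM => //; apply: measurable_funX; exact: measurable_pos_part.
by apply: measurable_funM => //; apply: measurable_funX; exact: measurable_neg_part.
Qed.

Variables (w : probability Rm R) (k0 : R).
Hypotheses (c_gt0 : 0 < c)
  (wg : is_density w (fun t => k0 * two_sided_gauss t)).

(** A nonpositive density would give the whole space a nonpositive mass. *)
Lemma density_const_gt0 : 0 < k0.
Proof.
rewrite ltNge; apply/negP => k00.
have : w setT = (- \int[leb]_x (- (k0 * two_sided_gauss x))%:E)%E.
  rewrite wg // -integral_ge0N.
    by apply: eq_integral => x _; rewrite EFinN oppeK.
  by move=> x _; rewrite lee_fin -mulNr mulr_ge0 ?oppr_ge0 // expR_ge0.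
rewrite probability_setT => e.
have : (1 <= 0 :> \bar R)%E.
  rewrite e oppe_le0; apply: integral_ge0 => x _.
  by rewrite lee_fin -mulNr mulr_ge0 ?oppr_ge0 // expR_ge0.
by rewrite lee_fin ler10.
Qed.

Let k0_ge0 : 0 <= k0. Proof. exact: ltW density_const_gt0. Qed.

Let f_ge0 t : 0 <= k0 * two_sided_gauss t.
Proof. by rewrite mulr_ge0 // expR_ge0. Qed.

Let mf : measurable_fun [set: Rm] (fun t : Rm => (k0 * two_sided_gauss t : Rm)).
Proof. by apply: measurable_funM => //; exact: measurable_two_sided_gauss. Qed.

Lemma right_density :
  w half = (k0 * tail_moment 0 beta c)%:E /\
  (\int[w]_(t in half) t%:E)%E = (k0 * tail_moment 1 beta c)%:E.
Proof.
apply: (half_line_density wg) => // t t0; congr (_ * expR _).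
have [-> ->] := pos_partE t0; ring.
Qed.

(** Reflection exchanges the two sides of the kink, and the curvature on the left
    is [1]. *)
Lemma left_density :
  w (`]-oo, 0%R]%classic : set R) = (k0 * tail_moment 0 (- beta) 1)%:E /\
  (\int[w]_(t in (`]-oo, 0%R]%classic : set R)) (- t)%:E)%E =
    (k0 * tail_moment 1 (- beta) 1)%:E.
Proof.
have mN : measurable_fun [set: Rm] (fun x : Rm => (- x : Rm)) by apply: measurable_funN.
pose s : {mfun Rm >-> Rm} := HB.pack (fun x : Rm => (- x : Rm))
  (@isMeasurableFun.Build _ _ _ _ _ mN).
have mfs : measurable_fun [set: Rm]
    ((fun t => k0 * two_sided_gauss t) \o (fun x : Rm => (- x : Rm))).
  by apply: measurableT_comp.
have ws : is_density (distribution w s)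
    ((fun t => k0 * two_sided_gauss t) \o (fun x : R => - x)).
  apply: density_pushforward => //; first exact: opprK.
  by move=> A mA; exact: lebesgue_measureN.
have [] := @half_line_density R (distribution w s) _ k0 (- beta) 1 ws _ mfs ltr01.
- by move=> x; exact: f_ge0.
- move=> t t0 /=; congr (_ * expR _).
  have nt0 : - t <= 0 by rewrite oppr_le0.
  have [-> ->] := neg_partE nt0.
  by rewrite opprK; field.
have e : s @^-1` half = (`]-oo, 0%R]%classic : set R).
  by apply/seteqP; split => z /=; rewrite !in_itv/= andbT oppr_ge0.
move=> h1 h2; split.
  by rewrite -h1 -e.
rewrite -h2 /distribution/= ge0_integral_pushforward //.
- by rewrite e.
- by move=> y; rewrite inE/= in_itv/= andbT lee_fin.
Qed.

Lemma atomless0 : w [set 0] = 0%E.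
Proof. by rewrite wg // integral_set1. Qed.

Lemma integral_pos_part :
  (\int[w]_t (pos_part t)%:E)%E = (k0 * tail_moment 1 beta c)%:E.
Proof.
rewrite -right_density.2 [RHS]integral_mkcond; apply: eq_integral => t _.
rewrite patchE; case: ifPn; rewrite ?notin_setE ?inE/= in_itv/= andbT.
  by move=> /pos_partE[->].
by move=> /negP; rewrite -ltNge => /ltW /neg_partE[->].
Qed.

Lemma integral_neg_part :
  (\int[w]_t (neg_part t)%:E)%E = (k0 * tail_moment 1 (- beta) 1)%:E.
Proof.
rewrite -left_density.2 [RHS]integral_mkcond; apply: eq_integral => t _.
rewrite patchE; case: ifPn; rewrite ?notin_setE ?inE/= in_itv/=.
  by move=> /neg_partE[_ ->].
by move=> /negP; rewrite -ltNge => /ltW /pos_partE[_ ->].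
Qed.

Lemma integral_right :
  (\int[w]_t ((0 <= t)%R%:R)%:E)%E = (k0 * tail_moment 0 beta c)%:E.
Proof.
rewrite -right_density.1 -[RHS]mul1e -integral_cst // [RHS]integral_mkcond.
apply: eq_integral => t _; rewrite patchE.
case: ifPn; rewrite ?notin_setE ?inE/= in_itv/= andbT; first by move=> ->.
by move=> /negP/negPf ->.
Qed.

Lemma integral_left :
  (\int[w]_t ((t < 0)%R%:R)%:E)%E = (k0 * tail_moment 0 (- beta) 1)%:E.
Proof.
rewrite -left_density.1.
have -> : w (`]-oo, 0%R]%classic : set R) = w (`]-oo, 0%R[%classic : set R).
  apply/eqP; rewrite eq_le; apply/andP; split; last first.
    by apply: le_measure; rewrite ?inE //; apply: subset_itvl; rewrite bnd_simp.
  have -> : (`]-oo, 0%R]%classic : set R) = (`]-oo, 0%R[%classic : set R) `|` [set 0].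
    apply/seteqP; split => z /=; rewrite !in_itv/= le_eqVlt.
      by move=> /orP[/eqP->|->]; [right|left].
    by move=> [->|->]; rewrite ?orbT ?eqxx.
  rewrite (le_trans (measureU2 _ _ _)) // -[leRHS]adde0 leeD2l //.
  by rewrite -[leRHS]atomless0.
rewrite -[RHS]mul1e -integral_cst // [RHS]integral_mkcond.
apply: eq_integral => t _; rewrite patchE.
case: ifPn; rewrite ?notin_setE ?inE/= in_itv/=; first by move=> ->.
by move=> /negP/negPf ->.
Qed.

Lemma integrable_pos_part : w.-integrable setT (EFin \o (fun t : R => pos_part t)).
Proof.
apply/integrableP; split; first by apply/measurable_EFinP; exact: measurable_pos_part.
under eq_integral do rewrite gee0_abs ?lee_fin ?pos_part_ge0 //.
by rewrite integral_pos_part ltry.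
Qed.

Lemma integrable_neg_part : w.-integrable setT (EFin \o (fun t : R => neg_part t)).
Proof.
apply/integrableP; split; first by apply/measurable_EFinP; exact: measurable_neg_part.
under eq_integral do rewrite gee0_abs ?lee_fin ?neg_part_ge0 //.
by rewrite integral_neg_part ltry.
Qed.

Lemma integrable_linear_growth (g : R -> R) C :
  measurable_fun [set: Rm] (g : Rm -> Rm) ->
  (forall t, `|g t| <= C * (1 + `|t|)) -> w.-integrable setT (EFin \o g).
Proof.
move=> mg gC; have intp := integrable_pos_part; have intn := integrable_neg_part.
have int1 : w.-integrable setT (EFin \o (fun=> C : R)).
  exact: finite_measure_integrable_cst.
apply: (@le_integrable _ _ _ w setT measurableT _
   (EFin \o (fun t : R => C + (C * pos_part t + C * neg_part t)))) => //.
- exact/measurable_EFinP.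
- move=> t _ /=; rewrite lee_fin (le_trans (gC t)) // (le_trans _ (ler_norm _)) //.
  have -> : `|t| = pos_part t + neg_part t.
    case: (lerP 0 t) => [t0|/ltW t0].
      by have [-> ->] := pos_partE t0; rewrite ger0_norm // addr0.
    by have [-> ->] := neg_partE t0; rewrite ler0_norm // add0r.
  by lra.
- have h := integrableD measurableT int1 (integrableD measurableT
    (integrableZl measurableT C intp) (integrableZl measurableT C intn)).
  by apply: eq_integrable h => // t _ /=; rewrite !EFinD !EFinM.
Qed.
End Diffusion.

(** * Lattice cells under the diffusion *)

Section Cells.
Context {R : realType}.
Notation leb := (@lebesgue_measure R).
Notation Rm := (measurableTypeR R).
Variables (beta c k0 d : R) (n : nat) (w : probability Rm R).
Hypotheses (c_gt0 : 0 < c) (d_gt0 : 0 < d)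
  (wg : is_density w (fun t => k0 * two_sided_gauss beta c t)).

(** A translate by [d] of the interval loses the factor [exp (- y)], where [y] is
    [d] times the restoring force at its left end, and [1 + y <= exp y]. *)
Lemma interval_mass_step (x : R) :
  (1 + d * restoring beta c x) * fine (w `[x + d, x + d + d[%classic) <=
  fine (w `[x, x + d[%classic).
Proof.
have k00 := ltW (density_const_gt0 wg).
have mg := measurable_two_sided_gauss beta c.
pose s : {mfun Rm >-> Rm} := HB.pack (fun x : Rm => (x + d : Rm))
  (@isMeasurableFun.Build _ _ _ _ _ (measurable_addr d)).
pose hi : set R := `[x + d, x + d + d[%classic.
pose lo : set R := `[x, x + d[%classic.
rewrite -/hi -/lo.
have mhi : measurable (hi : set Rm) by exact: measurable_itv.
have mlo : measurable (lo : set Rm) by exact: measurable_itv.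
set y := d * restoring beta c x.
have f0 t : 0 <= k0 * two_sided_gauss beta c t by rewrite mulr_ge0 // expR_ge0.
have mf : measurable_fun [set: Rm] (fun t : Rm => (k0 * two_sided_gauss beta c t : Rm)).
  by apply: measurable_funM.
have le : (w hi <= (expR (- y))%:E * w lo)%E.
  rewrite !wg // [leLHS](eq_measure_integral (pushforward leb s)) //; last first.
    move=> B mB _; exact/esym/lebesgue_measure_shift.
  rewrite ge0_integral_pushforward //; last 2 first.
  - by apply/measurable_EFinP; exact: measurable_funTS.
  - by move=> t _; rewrite lee_fin.
  have -> : s @^-1` hi = lo.
    by rewrite /hi /lo; apply/seteqP; split => z /=; rewrite !in_itv/= lerD2r ltrD2r //.
  rewrite -ge0_integralZl_EFin ?expR_ge0 //; last 2 first.
  - by move=> t _; rewrite lee_fin.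
  - by apply/measurable_EFinP; exact: measurable_funTS.
  apply: ge0_le_integral => //.
  - by move=> t _; rewrite lee_fin.
  - apply/measurable_EFinP; apply: measurable_funTS.
    by apply: (measurableT_comp mf); exact: measurable_addr.
  - by apply: emeasurable_funM => //; apply/measurable_EFinP; exact: measurable_funTS.
  - move=> t; rewrite /lo /= in_itv/= => /andP[xt _]; rewrite -EFinM lee_fin mulrCA.
    by rewrite ler_wpM2l // two_sided_gauss_step // ltW.
move: le; rewrite -[w hi]fineK ?fin_num_measure // -[w lo]fineK ?fin_num_measure //.
rewrite -EFinM lee_fin => le.
have q0 : 0 <= fine (w hi) by exact: fine_ge0.
apply: (@le_trans _ _ (expR y * fine (w hi))).
  by rewrite ler_wpM2r // expR_ge1Dx.
apply: (@le_trans _ _ (expR y * (expR (- y) * fine (w lo)))).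
  by rewrite ler_wpM2l // expR_ge0.
by rewrite mulrA -expRD subrr expR0 mul1r.
Qed.

(** Slot [k] collects the values of the diffusion between the positions
    [d (k + 1 - n)] and [d (k + 2 - n)] of the states [k + 1] and [k + 2] of the
    chain, so that slot [k] follows slot [k - 1] with a loss of mass that is
    controlled by the restoring force at the position of state [k] itself. *)
Definition slot (k : nat) : set R :=
  `[d * (k%:R - n%:R) + d, d * (k%:R - n%:R) + d + d[%classic.

(** Truncation puts all values below slot [1] into slot [0]. *)
Definition slot_index (t : R) : nat := Num.truncn (t / d + n%:R - 1).

(** A variant that never mixes the two sides of the kink: the values above it are
    assigned to states above [n], the values below it to states up to [n]. *)
Definition split_slot_index (t : R) : nat :=
  if t < 0 then slot_index t else maxn n.+1 (slot_index t).

(** When [d] is the step of the rescaled chain and the restoring force is that of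
    its diffusion limit, this is the ratio of the death rate to the birth rate in
    state [k]. *)
Definition rate (k : nat) : R := 1 + d * restoring beta c (d * (k%:R - n%:R)).

Lemma measurable_slot k : measurable (slot k : set Rm).
Proof. exact: measurable_itv. Qed.

(** The masses of the slots decrease at least as fast as the stationary mass
    function of the chain, for which the same relation is an equality. *)
Lemma slot_mass_step k :
  rate k.+1 * fine (w (slot k.+1)) <= fine (w (slot k)).
Proof.
have := interval_mass_step (d * (k.+1%:R - n%:R)).
rewrite /rate /slot -[k.+1%:R]natr1.
by rewrite (_ : d * (k%:R + 1 - n%:R) = d * (k%:R - n%:R) + d); last by ring.
Qed.

Lemma gt_slot_index m t : (m < slot_index t)%N = (d * (m%:R - n%:R) + d + d <= t).
Proof.
rewrite truncn_gt_nat -(ler_pM2r d_gt0) -natr1.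
have -> : (t / d + n%:R - 1) * d = t + d * (n%:R - 1) by field; rewrite gt_eqF.
by rewrite -subr_ge0 -[RHS]subr_ge0; congr (_ <= _); ring.
Qed.

Lemma slot_index_bound t : t <= d * ((slot_index t)%:R - n%:R) + d + d.
Proof.
have := gt_slot_index (slot_index t) t.
by rewrite ltnn => /esym/negbT; rewrite -ltNge => /ltW.
Qed.

Lemma slotE k t : slot k.+1 t <-> slot_index t = k.+1.
Proof.
rewrite /slot /= in_itv /=; have := gt_slot_index k t; have := gt_slot_index k.+1 t.
rewrite -natr1 (_ : d * (k%:R + 1 - n%:R) = d * (k%:R - n%:R) + d); last by ring.
set y := d * _ => h1 h2; split.
  move=> /andP[]; rewrite -h2 ltNge -h1 -leqNgt => kz zk.
  by apply/eqP; rewrite eqn_leq zk.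
by move=> e; rewrite -h2 ltNge -h1 e ltnn ltnSn.
Qed.

Lemma slot_sub k t : slot k t -> slot_index t = k.
Proof.
case: k => [|k /slotE //]; rewrite /slot /= in_itv /= => /andP[_].
by rewrite ltNge -gt_slot_index -leqNgt leqn0 => /eqP.
Qed.

Lemma slot_ge0 k t : (n <= k.+1)%N -> slot k t -> 0 <= t.
Proof.
rewrite /slot /= in_itv /= => nk /andP[+ _]; apply: le_trans.
have -> : d * (k%:R - n%:R) + d = d * (k.+1%:R - n%:R) by rewrite -natr1; ring.
by rewrite mulr_ge0 ?(ltW d_gt0) // subr_ge0 ler_nat.
Qed.

Lemma slot_lt0 k t : (k.+2 <= n)%N -> slot k t -> t < 0.
Proof.
rewrite /slot /= in_itv /= => nk /andP[_ tk]; apply: lt_le_trans tk _.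
have -> : d * (k%:R - n%:R) + d + d = d * (k.+2%:R - n%:R) by rewrite -!natr1; ring.
by rewrite mulr_ge0_le0 ?(ltW d_gt0) // subr_le0 ler_nat.
Qed.

Lemma slot_index_lt0 t : t < 0 -> (slot_index t <= n)%N.
Proof.
move=> t0; rewrite leqNgt gt_slot_index -ltNge (lt_le_trans t0) //.
by rewrite subrr mulr0 add0r addr_ge0 // ltW.
Qed.

Lemma measurable_nat_fun (z : Rm -> nat) :
  (forall m, measurable [set t | (m < z t)%N]) -> measurable_fun setT z.
Proof.
move=> mz _ A _; rewrite setTI.
have -> : z @^-1` A = \bigcup_(k in A) (z @^-1` [set k]).
  by apply/seteqP; split => [t zt|t [k Ak /= ->//]]; exists (z t).
apply: bigcup_measurable => -[|k] _.
  have -> : z @^-1` [set 0%N] = ~` [set t | (0 < z t)%N].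
    apply/seteqP; split => t /=; first by move=> ->.
    by rewrite lt0n => /negP/negbNE/eqP.
  exact: measurableC.
have -> : z @^-1` [set k.+1] = [set t | (k < z t)%N] `\` [set t | (k.+1 < z t)%N].
  apply/seteqP; split => t /= => [->|[h /negP]]; first by rewrite ltnn; split.
  by rewrite -leqNgt => h'; apply/eqP; rewrite eqn_leq h' h.
exact: measurableD.
Qed.

Lemma measurable_slot_index : measurable_fun [set: Rm] (slot_index : Rm -> nat).
Proof.
apply: measurable_nat_fun => m.
rewrite (_ : [set t | _] = `[d * (m%:R - n%:R) + d + d, +oo[%classic).
  exact: measurable_itv.
by apply/seteqP; split => t /=; rewrite in_itv/= andbT gt_slot_index.
Qed.

Lemma measurable_split_slot_index :
  measurable_fun [set: Rm] (split_slot_index : Rm -> nat).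
Proof.
apply: measurable_fun_ifT.
- exact: measurable_fun_ltr.
- exact: measurable_slot_index.
- by apply: measurable_fun_maxn => //; exact: measurable_slot_index.
Qed.
End Cells.

(** * The stationary chain *)

Lemma Rintegral_lin2 (d : measure_display) (T : measurableType d) (R : realType)
    (mu : {measure set T -> \bar R}) (f g : T -> R) (x y : R) :
  mu.-integrable setT (EFin \o f) -> mu.-integrable setT (EFin \o g) ->
  \int[mu]_t (x * f t + y * g t) = x * \int[mu]_t f t + y * \int[mu]_t g t.
Proof.
move=> fi gi; rewrite RintegralD //.
- by rewrite !RintegralZl.
- exact: (integrableZl measurableT x fi).
- exact: (integrableZl measurableT y gi).
Qed.

Lemma Rintegral_probability_cst (d : measure_display) (T : measurableType d)
  (R : realType) (P : probability T R) (r : R) : \int[P]_t r = r.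
Proof.
rewrite Rintegral_cst // -[RHS]mulr1; congr (_ * _).
exact: (congr1 fine (@probability_setT _ _ _ P)).
Qed.

Section Chain.
Context {R : realType}.
Variables (beta c d : R) (n : nat) (nu : probability nat R).
Hypotheses (c_gt0 : 0 < c) (d_gt0 : 0 < d).

Local Notation rate := (rate beta c d n).
Hypotheses (rate0 : rate 0 = 0)
  (balance : forall k, rate k.+1 * mass nu k.+1 = mass nu k).

Lemma rate_above k : (n <= k)%N -> rate k = 1 + d * beta + c * d * (d * (k - n)%:R).
Proof.
move=> nk; rewrite /rate /restoring.
have h : 0 <= d * (k%:R - n%:R).
  by rewrite mulr_ge0 ?(ltW d_gt0) // subr_ge0 ler_nat.
by have [-> ->] := pos_partE h; rewrite natrB //; ring.
Qed.

Lemma rate_below k : (k <= n)%N -> rate k = 1 + d * beta - d * (d * (n - k)%:R).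
Proof.
move=> nk; rewrite /rate /restoring.
have h : d * (k%:R - n%:R) <= 0.
  by rewrite mulr_ge0_le0 ?(ltW d_gt0) // subr_le0 ler_nat.
by have [-> ->] := neg_partE h; rewrite natrB //; ring.
Qed.

Lemma d_beta : 1 + d * beta = d ^+ 2 * n%:R.
Proof.
have := rate_below (leq0n n); rewrite rate0 subn0 => /esym/eqP.
by rewrite subr_eq0 => /eqP ->; ring.
Qed.

Let c1 := Num.min 1 c.

Let c1_gt0 : 0 < c1. Proof. by rewrite lt_min ltr01. Qed.

Lemma rate_ge k : c1 * d ^+ 2 * k%:R <= rate k.
Proof.
have d2 : 0 <= d ^+ 2 by exact: sqr_ge0.
have [c11 c1c] : c1 <= 1 /\ c1 <= c by rewrite !ge_min !lexx orbT.
case: (leqP k n) => kn.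
  rewrite rate_below // d_beta natrB //.
  have -> : d ^+ 2 * n%:R - d * (d * (n%:R - k%:R)) = 1 * (d ^+ 2 * k%:R) by ring.
  by rewrite -mulrA ler_wpM2r // mulr_ge0.
rewrite rate_above ?(ltnW kn) // d_beta.
have -> : c1 * d ^+ 2 * k%:R = c1 * (d ^+ 2 * n%:R) + c1 * (d ^+ 2 * (k - n)%:R).
  by rewrite natrB ?(ltnW kn) //; ring.
apply: lerD; first by rewrite -[leRHS]mul1r ler_wpM2r // mulr_ge0.
have -> : c * d * (d * (k - n)%:R) = c * (d ^+ 2 * (k - n)%:R) by ring.
by rewrite ler_wpM2r // mulr_ge0.
Qed.

Lemma rate_ge0 k : 0 <= rate k.
Proof.
apply: le_trans (rate_ge k); rewrite mulr_ge0 // mulr_ge0 ?sqr_ge0 //; exact: ltW.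
Qed.

Lemma rate_gt0 k : 0 < rate k.+1.
Proof.
apply: lt_le_trans (rate_ge k.+1).
by rewrite mulr_gt0 // ?ltr0n // mulr_gt0 // exprn_gt0.
Qed.

Lemma mass_gt0 k : 0 < mass nu k.
Proof.
rewrite lt_neqAle mass_ge0 andbT eq_sym; apply/eqP => mk.
have up j : mass nu (k + j) = 0.
  elim: j => [|j IH]; first by rewrite addn0.
  have := balance (k + j); rewrite IH => /eqP.
  by rewrite mulf_eq0 gt_eqF ?rate_gt0 //= addnS => /eqP.
have all0 j : mass nu j = 0.
  case: (leqP k j) => [/subnKC <- //|/ltnW/subnK].
  have down i : forall l, mass nu (i + l) = 0 -> mass nu l = 0.
    by elim: i => // i IH l h; apply: IH; rewrite -balance -addSn h mulr0.
  by move=> e; apply: (down (k - j)%N); rewrite e.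
have h := @cvg_partial_sums _ nu (cst 1)
  (finite_measure_integrable_cst _ _ measurableT).
have : \int[nu]_k (cst 1 k : R) = 0.
  rewrite -(cvg_lim _ h) // (_ : (fun N => _) = cst 0) ?lim_cst //.
  by apply/funext => N; rewrite big1 // => i _; rewrite all0 mulr0.
by rewrite [LHS]Rintegral_probability_cst => /eqP; rewrite oner_eq0.
Qed.

Lemma stein_chain (f : nat -> R) : (forall k, 0 <= f k) ->
  \int[nu]_k (rate k * f k) = \int[nu]_k f k.+1.
Proof.
move=> f0; congr fine.
exact: (mass_shift_integral rate_ge0 rate0 balance f0).
Qed.

(** The rate grows linearly and the Stein identity for the constant [1] says that
    its mean is [1]. *)
Lemma integrable_linear_growth_nat (f : nat -> R) C :
  (forall k, `|f k| <= C * (1 + k%:R)) -> nu.-integrable setT (EFin \o f).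
Proof.
move=> fC.
have ir : nu.-integrable setT (EFin \o rate).
  apply/integrableP; split => //.
  under eq_integral do rewrite /= ger0_norm ?rate_ge0 // -[rate _]mulr1.
  rewrite (mass_shift_integral rate_ge0 rate0 balance (fun=> ler01)).
  rewrite (integral_cst nu measurableT 1%:E) mul1e.
  by rewrite [X in (X < _)%E](@probability_setT _ _ _ nu) ltry.
have C0 : 0 <= C by have := le_trans (normr_ge0 _) (fC 0%N); rewrite addr0 mulr1.
have cd : 0 < c1 * d ^+ 2 by rewrite mulr_gt0 // exprn_gt0.
have i1 : nu.-integrable setT (EFin \o (fun=> C)).
  exact: finite_measure_integrable_cst.
have ib := integrableD measurableT i1 (integrableZl measurableT (C / (c1 * d ^+ 2)) ir).
apply: le_integrable ib => //.
move=> k _ /=; rewrite lee_fin (le_trans (fC k)) // (le_trans _ (ler_norm _)) //.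
rewrite mulrDr mulr1 lerD2l -mulrA ler_wpM2l // mulrC ler_pdivlMr // mulrC.
exact: rate_ge.
Qed.

Lemma integrable_bool (p : pred nat) :
  nu.-integrable setT (EFin \o (fun k => (p k)%:R : R)).
Proof.
apply: (@integrable_linear_growth_nat _ 1) => k.
by rewrite mul1r; case: (p k); rewrite ?normr1 ?normr0 ?lerDl ?addr_ge0.
Qed.

Lemma integrable_excess : nu.-integrable setT (EFin \o (fun k => d * (k - n)%:R)).
Proof.
apply: (@integrable_linear_growth_nat _ d) => k.
rewrite normrM gtr0_norm // ger0_norm // ler_wpM2l ?(ltW d_gt0) //.
by rewrite (@le_trans _ _ k%:R) ?lerDr // ler_nat leq_subr.
Qed.

Lemma integrable_shortfall : nu.-integrable setT (EFin \o (fun k => d * (n - k)%:R)).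
Proof.
apply: (@integrable_linear_growth_nat _ (d * n%:R)) => k.
rewrite normrM gtr0_norm // ger0_norm // -mulrA ler_wpM2l ?(ltW d_gt0) //.
by rewrite mulrDr mulr1 (@le_trans _ _ n%:R) ?lerDl ?mulr_ge0 // ler_nat leq_subr.
Qed.

Lemma integral_eq1 j : \int[nu]_k ((k == j)%:R : R) = mass nu j.
Proof.
rewrite /Rintegral /mass; congr fine.
rewrite -[in RHS](setIT [set j]) -integral_indic //.
apply: eq_integral => k _; rewrite indicE; congr ((nat_of_bool _)%:R%:E).
by apply/eqP/idP; rewrite inE.
Qed.

Definition prob_above : R := \int[nu]_k (n < k)%N%:R.
Definition mean_above : R := \int[nu]_k (d * (k - n)%:R).
Definition mean_below : R := \int[nu]_k (d * (n - k)%:R).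

Lemma prob_below : \int[nu]_k ((k <= n)%N%:R : R) = 1 - prob_above.
Proof.
rewrite -[X in X - _](Rintegral_probability_cst nu).
rewrite -RintegralB //; last 2 first.
- exact: (integrable_bool predT).
- exact: integrable_bool.
by apply: eq_Rintegral => k _; rewrite leqNgt; case: ltnP; rewrite ?subrr ?subr0.
Qed.

Lemma prob_above_gt0 : 0 < prob_above.
Proof.
apply: lt_le_trans (mass_gt0 n.+1) _; rewrite -integral_eq1.
apply: le_Rintegral => //.
- exact: (integrable_bool (pred1 n.+1)).
- exact: integrable_bool.
- by move=> k _; case: eqP => [->|_] //; rewrite ltnSn.
Qed.

Lemma prob_above_lt1 : prob_above < 1.
Proof.
rewrite -subr_gt0 -prob_below; apply: lt_le_trans (mass_gt0 n) _; rewrite -integral_eq1.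
apply: le_Rintegral => //.
- exact: (integrable_bool (pred1 n)).
- exact: integrable_bool.
- by move=> k _; case: eqP => [->|_] //; rewrite leqnn.
Qed.

(** The Stein identity for the indicator of the states above [n]. *)
Lemma mean_above_eq : c * mean_above = mass nu n / d - beta * prob_above.
Proof.
have := @stein_chain (fun k => (n < k)%N%:R) (fun k => ler0n _ _).
rewrite (@eq_Rintegral _ _ _ nu _ (fun k =>
  (1 + d * beta) * (n < k)%N%:R + (c * d) * (d * (k - n)%:R))); last first.
  move=> k _; case: ltnP => nk; first by rewrite rate_above ?(ltnW nk) //=; ring.
  by rewrite (eqP (_ : (k - n)%N == 0%N)) //=; ring.
rewrite Rintegral_lin2; [|exact: integrable_bool|exact: integrable_excess].
rewrite -/prob_above -/mean_above.
rewrite (@eq_Rintegral _ _ _ nu _ (fun k =>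
  1 * (n < k)%N%:R + 1 * (k == n)%:R)); last first.
  move=> k _; rewrite ltnS leq_eqVlt eq_sym.
  by case: eqP => [->|_]; rewrite ?ltnn /=; ring.
rewrite Rintegral_lin2; [|exact: integrable_bool|exact: (integrable_bool (pred1 n))].
rewrite integral_eq1 -/prob_above => e.
have d0 : d != 0 by rewrite gt_eqF.
have : d * (c * mean_above) = mass nu n - d * beta * prob_above by lra.
move=> e'; apply: (mulfI d0); rewrite e'; field; exact: d0.
Qed.

(** The Stein identity for the indicator of the states up to [n]. *)
Lemma mean_below_eq : mean_below = mass nu n / d + beta * (1 - prob_above).
Proof.
have := @stein_chain (fun k => (k <= n)%N%:R) (fun k => ler0n _ _).
rewrite (@eq_Rintegral _ _ _ nu _ (fun k =>
  (1 + d * beta) * (k <= n)%N%:R + (- d) * (d * (n - k)%:R))); last first.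
  move=> k _; case: leqP => nk; first by rewrite rate_below //=; ring.
  by rewrite (eqP (_ : (n - k)%N == 0%N)) ?subn_eq0 ?(ltnW nk) //=; ring.
rewrite Rintegral_lin2; [|exact: integrable_bool|exact: integrable_shortfall].
rewrite prob_below -/mean_below.
rewrite (@eq_Rintegral _ _ _ nu _ (fun k =>
  1 * (k <= n)%N%:R + (-1) * (k == n)%:R)); last first.
  move=> k _; rewrite [(k <= n)%N]leq_eqVlt.
  by case: eqP => [->|_]; rewrite ?ltnn /=; ring.
rewrite Rintegral_lin2; [|exact: integrable_bool|exact: (integrable_bool (pred1 n))].
rewrite integral_eq1 prob_below => e.
have d0 : d != 0 by rewrite gt_eqF.
have : d * mean_below = mass nu n + d * beta * (1 - prob_above) by lra.
move=> e'; apply: (mulfI d0); rewrite e'; field; exact: d0.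
Qed.

(** The hazard of the chain at the kink, [P (X = n) / (d P (X > n))], exceeds that
    of the diffusion, [1 / tail_moment 0 beta c], by at most [c * d].  The proof applies the Stein identity of the
    chain to [J (k - n - 1)] on the states [k > n], where [J j] is the ratio of
    tail mass to density of the diffusion at the position of state [n + j]; the
    convexity of that ratio bounds the left-hand side, and the terms in
    [J (k - n)] cancel. *)
Lemma hazard_le :
  mass nu n / d * tail_moment 0 beta c <=
  (1 + c * d * tail_moment 0 beta c) * prob_above.
Proof.
pose J j := tail_moment 0 (beta + c * d * j%:R) c.
have cd0 : 0 <= c * d by rewrite ltW // mulr_gt0.
have J0 j : 0 <= J j by exact: tail_moment_ge0.
have Jle j : J j <= J 0%N.
  by rewrite /J mulr0 addr0 tail_moment0_decr // mulr_ge0.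
have Jstep j : (1 + d * (beta + c * d * j%:R)) * J j - d <= J j.+1.
  have := tail_moment0_convex (beta + c * d * j%:R) c_gt0 (ltW d_gt0).
  rewrite /J -[j.+1%:R]natr1.
  by rewrite (_ : beta + c * d * j%:R + c * d = beta + c * d * (j%:R + 1)) //; ring.
have iJ f (p : pred nat) : nu.-integrable setT (EFin \o (fun k => (p k)%:R * J (f k))).
  apply: (@integrable_linear_growth_nat _ (J 0%N)) => k.
  rewrite ger0_norm ?mulr_ge0 //; case: (p k); rewrite ?mul1r ?mul0r.
    by rewrite (le_trans (Jle _)) // ler_peMr // lerDl.
  by rewrite mulr_ge0 // addr_ge0.
have := @stein_chain (fun k => (n < k)%N%:R * J (k - n.+1)%N)
  (fun k => mulr_ge0 (ler0n _ _) (J0 _)).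
rewrite (@eq_Rintegral _ _ _ nu _
  (fun k => J 0%N * (k == n)%:R + 1 * ((n < k)%N%:R * J (k - n)%N))
  (fun k => (n < k.+1)%N%:R * J (k.+1 - n.+1)%N)); last first.
  move=> k _; rewrite subSS ltnS leq_eqVlt eq_sym.
  by case: eqP => [->|_]; rewrite ?ltnn ?subnn /=; ring.
rewrite Rintegral_lin2; [|exact: (integrable_bool (pred1 n))|exact: iJ].
rewrite integral_eq1 mul1r => e.
pose G (k : nat) : R :=
  (d + c * d ^+ 2 * J 0%N) * (n < k)%N%:R + 1 * ((n < k)%N%:R * J (k - n)%N).
have : \int[nu]_k (rate k * ((n < k)%N%:R * J (k - n.+1)%N)) <= \int[nu]_k G k.
  have ir : nu.-integrable setT (EFin \o G).
    exact: (integrableD measurableT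
      (integrableZl measurableT _ (integrable_bool (fun k => n < k)%N))
      (integrableZl measurableT _ (iJ _ _))).
  have pt k : rate k * ((n < k)%N%:R * J (k - n.+1)%N) <= G k.
    rewrite /G.
    case: ltnP => nk; last by rewrite !mul0r !mulr0 addr0.
    rewrite !mul1r mulr1 rate_above ?(ltnW nk) // -(subnSK nk) -[_.+1%:R]natr1.
    set j := (k - n.+1)%N.
    have := Jstep j; have : c * d ^+ 2 * J j <= c * d ^+ 2 * J 0%N.
      by rewrite ler_wpM2l // mulr_ge0 ?sqr_ge0 // ltW.
    by lra.
  apply: le_Rintegral => //.
  apply: le_integrable ir => // k _ /=; rewrite lee_fin ger0_norm.
    by rewrite (le_trans (pt k)) // ler_norm.
  by rewrite mulr_ge0 ?rate_ge0 // mulr_ge0.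
rewrite e /G Rintegral_lin2; [|exact: integrable_bool|exact: iJ].
rewrite mul1r lerD2r -/prob_above.
have -> : J 0%N = tail_moment 0 beta c by rewrite /J mulr0 addr0.
set T := tail_moment 0 beta c => h.
rewrite -(ler_pM2l d_gt0).
have -> : d * (mass nu n / d * T) = T * mass nu n by field; rewrite gt_eqF.
by lra.
Qed.
End Chain.

(** * Comparison of the chain with the diffusion *)

(** Bookkeeping behind the comparison of the means.  Primed letters belong to
    the diffusion, the others to the chain: [P] is the probability of lying above
    the kink, [A] and [B] the mean excess above and the mean shortfall below it,
    [h] and [f] the (rescaled) mass and density at it.  The two comparisons of
    conditional means give [P - P'] at most
    [2 d (c + 1 - P') P' (1 - P') / f], so that moving the surplus [P - P'] of mass
    up by the mean excess [A' / P'] costs a bounded number of steps: the term in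
    [c] because [c A' (1 - P') <= f], the other one because [A' f <= P' ^ 2]
    and [P' (1 - P') <= K f]. *)
Lemma overshoot_bound (R : realFieldType) (c d f beta P P' A A' B B' h K : R) :
  0 < c -> 0 < d -> 0 < f -> 0 < P -> P < 1 -> 0 < P' -> P' < 1 ->
  0 <= A' -> 0 <= B' -> 0 <= K ->
  c * A = h - beta * P -> B = h + beta * (1 - P) ->
  c * A' = f - beta * P' -> B' = f + beta * (1 - P') ->
  h * P' <= (f + c * d * P') * P ->
  A' * P <= (A + 2 * d * P) * P' ->
  B * (1 - P') <= (B' + 2 * d * (1 - P')) * (1 - P) ->
  A' * f <= P' ^+ 2 ->
  (1 - P') * P' <= K * f ->
  A - A' <= (3 + 2 * K ^+ 2) * d.
Proof.
move=> c0 d0 f0 P0 P1 P'0 P'1 A'0 B'0 K0 cA eB cA' eB' ha hb hc hd he.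
have F0 : 0 < 1 - P' by rewrite subr_gt0.
(* above the kink the conditional mean of the chain exceeds the other one by at
   most one step *)
have A_le : A * P' <= (A' + d * P') * P.
  rewrite -(ler_pM2l c0).
  have -> : c * (A * P') = h * P' - beta * P * P' by rewrite mulrA cA; ring.
  have -> : c * ((A' + d * P') * P) = (f + c * d * P') * P - beta * P * P'.
    have -> : c * ((A' + d * P') * P) = c * A' * P + c * d * P' * P by ring.
    by rewrite cA'; ring.
  by rewrite lerD2r.
have K2 : 0 <= K ^+ 2 * d by apply: mulr_ge0; [exact: sqr_ge0|exact: ltW].
have [PP'|P'P] := lerP P P'.
  have : A * P' <= (A' + d) * P'.
    apply: le_trans A_le _; have : 0 <= (P' - P) * A' by apply: mulr_ge0 => //; lra.
    have : 0 <= (1 - P) * (d * P').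
      by apply: mulr_ge0; [lra|apply: mulr_ge0; exact: ltW].
    lra.
  by rewrite ler_pM2r // => A_le'; have := mulr_ge0 (ltW d0) (sqr_ge0 K); lra.
(* both drifts average to [- beta] below; the comparisons of conditional means
   leave only the difference of the masses *)
have key : (P - P') * f <= 2 * d * (c + (1 - P')) * P' * (1 - P').
  have e1 : - beta = c * A - B by rewrite cA eB; ring.
  have e2 : - beta = c * A' - B' by rewrite cA' eB'; ring.
  have h1 : c * (1 - P') * (A' * P) <= c * (1 - P') * ((A + 2 * d * P) * P').
    by apply: ler_wpM2l => //; apply: mulr_ge0; exact: ltW.
  have h2 : P' * (B * (1 - P')) <= P' * ((B' + 2 * d * (1 - P')) * (1 - P)).
    by apply: ler_wpM2l => //; exact: ltW.
  have h3 : c * A * P' * (1 - P') - B * P' * (1 - P') =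
            (c * A' - B') * P' * (1 - P').
    by rewrite -e2 e1; ring.
  have h4 : (P - P') * f = (P - P') * (c * A' * (1 - P') + B' * P').
    by rewrite cA' eB'; ring.
  have h5 : 2 * d * (c * P + (1 - P)) * (P' * (1 - P')) <=
            2 * d * (c + (1 - P')) * (P' * (1 - P')).
    apply: ler_wpM2r; first by apply: mulr_ge0; exact: ltW.
    rewrite ler_pM2l ?mulr_gt0 //.
    have c1P : 0 <= c * (1 - P) by apply: mulr_ge0; lra.
    by lra.

  rewrite h4; lra.
have DP : (A - A') * P' <= (P - P') * A' + d * P * P' by lra.
have e'f : (P - P') * A' * f <= (2 + 2 * K ^+ 2) * d * P' * f.
  have cA'f : c * A' * (1 - P') <= f.
    have := mulr_ge0 B'0 (ltW P'0).
    have -> : B' * P' = f - c * A' * (1 - P') by rewrite cA' eB'; ring.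
    by rewrite subr_ge0.
  have h1 : (P - P') * f * A' <= 2 * d * (c + (1 - P')) * P' * (1 - P') * A'.
    by apply: ler_wpM2r.
  have h2 : 2 * d * P' * (c * A' * (1 - P')) <= 2 * d * P' * f.
    apply: ler_wpM2l => //; apply: ltW; apply: mulr_gt0 => //; exact: mulr_gt0.
  have h3 : (1 - P') ^+ 2 * A' <= K ^+ 2 * f.
    rewrite -(ler_pM2r f0) -mulrA.
    apply: (@le_trans _ _ ((1 - P') ^+ 2 * P' ^+ 2)).
      by rewrite ler_wpM2l ?sqr_ge0.
    have -> : K ^+ 2 * f * f = (K * f) ^+ 2 by ring.
    rewrite -exprMn; apply: lerXn2r => //; rewrite nnegrE.
      by apply: mulr_ge0; exact: ltW.
    by apply: mulr_ge0 => //; exact: ltW.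
  have h4 : 2 * d * P' * ((1 - P') ^+ 2 * A') <= 2 * d * P' * (K ^+ 2 * f).
    apply: ler_wpM2l => //; apply: ltW; apply: mulr_gt0 => //; exact: mulr_gt0.
  lra.
have {}e'f : (P - P') * A' <= (2 + 2 * K ^+ 2) * d * P' by rewrite -(ler_pM2r f0).
have h6 : d * P * P' <= d * P'.
  by rewrite mulrAC ler_piMr ?(ltW P1) //; apply: mulr_ge0; exact: ltW.
rewrite -(ler_pM2r P'0); lra.
Qed.

Section Comparison.
Context {R : realType}.
Notation Rm := (measurableTypeR R).
Variables (beta c k0 d : R) (n : nat) (w : probability Rm R) (nu : probability nat R).
Hypotheses (c_gt0 : 0 < c) (d_gt0 : 0 < d)
  (wg : is_density w (fun t => k0 * two_sided_gauss beta c t))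
  (rate0 : rate beta c d n 0 = 0)
  (balance : forall k, rate beta c d n k.+1 * mass nu k.+1 = mass nu k).

Let q k := fine (w (slot d n k)).

(** The chain has the larger likelihood ratios: its ratios [1 / rate k] are upper
    bounds for those of the slots. *)
Lemma slot_likelihood_ratio i j : (i <= j)%N -> mass nu i * q j <= mass nu j * q i.
Proof.
move=> /subnK <-; elim: (j - i)%N => [|m IH]; first by rewrite mulrC.
have r0 := rate_gt0 c_gt0 d_gt0 rate0 (m + i).
rewrite addSn -(ler_pM2l r0) [leRHS]mulrA balance mulrCA.
apply: le_trans IH; rewrite ler_wpM2l ?mass_ge0 //.
exact: (slot_mass_step n c_gt0 d_gt0 wg (m + i)).
Qed.

(** [z] rounds the diffusion to states of the chain.  On the index set [I] it may
    enlarge the lowest slot and empty the highest ones: both only push the rounded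
    diffusion further below the chain. *)
Lemma discretized_order (z : Rm -> nat) (I : pred nat) (phi : nat -> R) C C' :
  measurable_fun setT z ->
  (forall t, (z t)%:R <= C * (1 + `|t|)) -> (forall k, `|phi k| <= C' * (1 + k%:R)) ->
  (forall i j, I i -> I j -> (i < j)%N -> phi i <= phi j) ->
  (forall i j, I i -> I j -> (i < j)%N ->
    z @^-1` [set j] `<=` slot d n j /\
    (slot d n i `<=` z @^-1` [set i] \/ z @^-1` [set j] = set0)) ->
  (\int[w]_t (phi (z t) * (I (z t))%:R)) * (\int[nu]_k (I k)%:R) <=
  (\int[nu]_k (phi k * (I k)%:R)) * (\int[w]_t (I (z t))%:R).
Proof.
move=> mz zC phiC phiI zslot.
pose Z : {mfun Rm >-> nat} := HB.pack z (@isMeasurableFun.Build _ _ _ _ _ mz).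
have C0 : 0 <= C by have := le_trans (ler0n _ _) (zC 0); rewrite normr0 addr0 mulr1.
have C'0 : 0 <= C' by have := le_trans (normr_ge0 _) (phiC 0%N); rewrite addr0 mulr1.
have phiIC k : `|phi k * (I k)%:R| <= C' * (1 + k%:R).
  rewrite normrM [X in _ * X]ger0_norm // (le_trans _ (phiC k)) //.
  by case: (I k); rewrite ?mulr1 ?mulr0.
have intw (f : nat -> R) K : (forall k, `|f k| <= K * (1 + k%:R)) ->
    w.-integrable setT (EFin \o (f \o z)).
  move=> fK.
  have K0 : 0 <= K by have := le_trans (normr_ge0 _) (fK 0%N); rewrite addr0 mulr1.
  apply: (@integrable_linear_growth _ _ _ _ _ c_gt0 wg _ (K * (1 + C))).
    exact: (measurableT_comp _ mz).
  move=> t; rewrite (le_trans (fK _)) // -mulrA ler_wpM2l //.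
  rewrite mulrDl mul1r; apply: lerD (zC t).
  by rewrite lerDl.
have intrho (f : nat -> R) K : (forall k, `|f k| <= K * (1 + k%:R)) ->
    (distribution w Z).-integrable setT (EFin \o f).
  move=> fK; apply: integrable_pushforward => //; rewrite preimage_setT.
  exact: (intw _ K).
have bI k : `|(I k)%:R| <= 1 * (1 + k%:R) :> R.
  by rewrite mul1r; case: (I k); rewrite ?normr1 ?normr0 ?lerDl ?addr_ge0.
have tr (f : nat -> R) K : (forall k, `|f k| <= K * (1 + k%:R)) ->
    \int[distribution w Z]_k f k = \int[w]_t f (z t).
  by move=> fK; rewrite /Rintegral integral_distribution //; exact: (intw _ K).
have := @likelihood_ratio_order _ nu (distribution w Z) I phi.
rewrite !(tr _ _ phiIC) !(tr _ _ bI); apply => //.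
- exact: (integrable_linear_growth_nat c_gt0 d_gt0 rate0 balance phiIC).
- exact: (intrho _ C').
- move=> i j Ii Ij ij; have [zj zi] := zslot i j Ii Ij ij.
  have mZ k : measurable (Z @^-1` [set k]) by exact: (measurable_funPTI Z).
  have fine_mass_le (A B : set Rm) : measurable A -> measurable B -> A `<=` B ->
      fine (w A) <= fine (w B).
    move=> mA mB AB; apply: fine_le; [exact: fin_num_measure..|].
    by apply: le_measure; rewrite ?inE.
  have massj : mass (distribution w Z) j <= q j.
    by apply: fine_mass_le => //; exact: measurable_slot.
  case: zi => [zi|z0]; last first.
    have -> : mass (distribution w Z) j = fine (w (z @^-1` [set j])) by [].
    by rewrite z0 measure0 mulr0 mulr_ge0 ?mass_ge0 // fine_ge0.
  have massi : q i <= mass (distribution w Z) i.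
    by apply: fine_mass_le => //; exact: measurable_slot.
  apply: (le_trans (ler_wpM2l (mass_ge0 nu i) massj)).
  apply: (le_trans (slot_likelihood_ratio (ltnW ij))).
  exact: (ler_wpM2l (mass_ge0 nu j) massi).
Qed.

Lemma slot_index_growth t : (slot_index d n t)%:R <= (d^-1 + n%:R) * (1 + `|t|).
Proof.
have nt : 0 <= n%:R * `|t| by rewrite mulr_ge0.
have dt : 0 <= d^-1 by rewrite invr_ge0 ltW.
have td : 0 <= d^-1 * `|t| by rewrite mulr_ge0.
have n0 : 0 <= n%:R :> R by [].
case e : (slot_index d n t) => [|m]; first by rewrite mulr0n; lra.
have := gt_slot_index n d_gt0 m t; rewrite e ltnSn => /esym h.
have : d * (m.+1%:R - n%:R) <= `|t|.
  rewrite (le_trans _ (ler_norm _)) // (le_trans _ h) // -natr1.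
  by have := ltW d_gt0; lra.
rewrite mulrC -ler_pdivlMr // mulrC; lra.
Qed.

Lemma split_slot_index_growth t :
  (split_slot_index d n t)%:R <= (d^-1 + n%:R + n.+1%:R) * (1 + `|t|).
Proof.
have h := slot_index_growth t.
have h0 : 0 <= n.+1%:R * (1 + `|t|) by rewrite mulr_ge0 // addr_ge0.
rewrite mulrDl /split_slot_index; case: ifP => _; first by lra.
rewrite (@le_trans _ _ (n.+1%:R + (slot_index d n t)%:R)) //.
  by rewrite -natrD ler_nat geq_max leq_addr leq_addl.
have : n.+1%:R <= n.+1%:R * (1 + `|t|) by rewrite ler_peMr // lerDl.
by lra.
Qed.

(** The rescaled chain, moved up by two steps, dominates the diffusion: a value in
    slot [k] lies below the position of the state [k + 2]. *)
Lemma stochastic_order (psi : R -> R) K :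
  {homo psi : x y / x <= y} -> (forall t, `|psi t| <= K * (1 + `|t|)) ->
  \int[w]_t psi t <= \int[nu]_k psi (d * (k%:R - n%:R) + d + d).
Proof.
move=> psi_le psiK.
have K0 : 0 <= K by have := le_trans (normr_ge0 _) (psiK 0); rewrite normr0 addr0 mulr1.
have mpsi : measurable_fun [set: Rm] (psi : Rm -> Rm).
  exact: nondecreasing_measurable.
have d0 := ltW d_gt0.
pose phi (k : nat) : R := psi (d * (k%:R - n%:R) + d + d).
have phiC k : `|phi k| <= K * (1 + d * n%:R + 3 * d) * (1 + k%:R).
  rewrite (le_trans (psiK _)) // -mulrA ler_wpM2l //.
  have k_ge0 : 0 <= k%:R :> R by [].
  have dk : 0 <= d * k%:R by rewrite mulr_ge0.
  have dn : 0 <= d * n%:R by rewrite mulr_ge0.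
  have dnk : 0 <= d * n%:R * k%:R by rewrite mulr_ge0.
  have : `|d * (k%:R - n%:R) + d + d| <= d * k%:R + d * n%:R + d + d.
    by rewrite ler_norml; apply/andP; split; lra.
  by lra.
have := @discretized_order (slot_index d n) xpredT phi _ _
  (measurable_slot_index n d_gt0) slot_index_growth phiC.
have e1 : \int[nu]_k ((true : nat)%:R : R) = 1 by exact: Rintegral_probability_cst.
have e2 : \int[w]_t ((true : nat)%:R : R) = 1 by exact: Rintegral_probability_cst.
rewrite e1 e2 !mulr1 => h.
have {}h : \int[w]_t phi (slot_index d n t) <= \int[nu]_k phi k.
  under eq_Rintegral do rewrite -[phi _]mulr1.
  under [leRHS]eq_Rintegral do rewrite -[phi _]mulr1.
  apply: h => [i j _ _ ij|i j _ _ ij].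
    by apply: psi_le; rewrite !lerD2r ler_wpM2l // lerD2r ler_nat ltnW.
  split; last by left => t /(slot_sub d_gt0).
  by case: j ij => // j _ t /(slotE n d_gt0).
apply: le_trans h.
have iw1 : w.-integrable setT (EFin \o psi).
  exact: (integrable_linear_growth c_gt0 wg mpsi psiK).
apply: le_Rintegral => //.
- apply: (@integrable_linear_growth _ _ _ _ _ c_gt0 wg _
    (K * (1 + d * n%:R + 3 * d) * (1 + (d^-1 + n%:R)))).
    have mphi : measurable_fun setT phi by [].
    exact: (measurableT_comp mphi (measurable_slot_index n d_gt0)).
  move=> t; rewrite (le_trans (phiC _)) // -[leRHS]mulrA ler_wpM2l //.
    by rewrite mulr_ge0 // !addr_ge0 // mulr_ge0.
  by rewrite mulrDl mul1r; apply: lerD (slot_index_growth t); rewrite lerDl.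
- by move=> t _; apply: psi_le; exact: (slot_index_bound n d_gt0).
Qed.

Let P := prob_above n nu.
Let A := mean_above d n nu.
Let B := mean_below d n nu.
Let P' := k0 * tail_moment 0 beta c.
Let F' := k0 * tail_moment 0 (- beta) 1.
Let A' := k0 * tail_moment 1 beta c.
Let B' := k0 * tail_moment 1 (- beta) 1.

Lemma integral_pos_partR : \int[w]_t pos_part t = A'.
Proof. by rewrite /Rintegral (integral_pos_part c_gt0 wg). Qed.

Lemma integral_neg_partR : \int[w]_t neg_part t = B'.
Proof. by rewrite /Rintegral (integral_neg_part wg). Qed.

Lemma integral_rightR : \int[w]_t ((0 <= t)%R%:R : R) = P'.
Proof. by rewrite /Rintegral (integral_right c_gt0 wg). Qed.

Lemma integral_leftR : \int[w]_t ((t < 0)%R%:R : R) = F'.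
Proof. by rewrite /Rintegral (integral_left wg). Qed.

Lemma integrable_indicator (p : R -> bool) :
  measurable_fun [set: Rm] (p : Rm -> bool) ->
  w.-integrable setT (EFin \o (fun t => (p t)%:R : R)).
Proof.
move=> mp; apply: (@integrable_linear_growth _ _ _ _ _ c_gt0 wg _ 1).
  have -> : (fun t => (p t)%:R : R) = (fun t => if p t then 1 else 0).
    by apply/funext => t; case: (p t).
  exact: measurable_fun_ifT.
by move=> t; rewrite mul1r; case: (p t); rewrite ?normr1 ?normr0 ?lerDl ?addr_ge0.
Qed.

Lemma integrable_split (f : nat -> R) C : (forall k, `|f k| <= C * (1 + k%:R)) ->
  w.-integrable setT (EFin \o (fun t => f (split_slot_index d n t))).
Proof.
move=> fC.
have C0 : 0 <= C by have := le_trans (normr_ge0 _) (fC 0%N); rewrite addr0 mulr1.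
apply: (@integrable_linear_growth _ _ _ _ _ c_gt0 wg _
  (C * (1 + (d^-1 + n%:R + n.+1%:R)))).
  have mf : measurable_fun setT f by [].
  exact: (measurableT_comp mf (measurable_split_slot_index n d_gt0)).
move=> t; rewrite (le_trans (fC _)) // -[leRHS]mulrA ler_wpM2l //.
by rewrite mulrDl mul1r; apply: lerD (split_slot_index_growth t); rewrite lerDl.
Qed.

Lemma split_slot_index_gt t : (n < split_slot_index d n t)%N = (0 <= t).
Proof.
rewrite /split_slot_index; case: ltP => t0; last by rewrite leq_max leqnn.
by apply/negbTE; rewrite -leqNgt slot_index_lt0.
Qed.

(** Conditionally on lying above the kink, the chain moved up by two steps
    dominates the diffusion in the mean. *)
Lemma mean_above_order : A' * P <= (A + 2 * d * P) * P'.
Proof.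
have d0 := ltW d_gt0.
pose I := (fun k => n < k)%N; pose phi (k : nat) : R := d * (k - n)%:R.
have phiC k : `|phi k| <= d * (1 + k%:R).
  rewrite ger0_norm ?mulr_ge0 // ler_wpM2l //.
  by rewrite (@le_trans _ _ k%:R) ?lerDr // ler_nat leq_subr.
have bC k : `|phi k * (I k)%:R| <= d * (1 + k%:R).
  rewrite normrM [X in _ * X]ger0_norm // (le_trans _ (phiC k)) //.
  by case: (I k); rewrite ?mulr1 ?mulr0.
have := @discretized_order (split_slot_index d n) I phi _ _
   (measurable_split_slot_index n d_gt0) split_slot_index_growth phiC.
have -> : \int[w]_t ((I (split_slot_index d n t))%:R : R) = P'.
  rewrite -integral_rightR; apply: eq_Rintegral => t _.
  by rewrite /I split_slot_index_gt.
have -> : \int[nu]_k (phi k * (I k)%:R) = A.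
  apply: eq_Rintegral => k _; rewrite /I /phi; case: ltnP => nk; rewrite ?mulr1 //.
  by rewrite (eqP (_ : (k - n)%N == 0%N)) // !mulr0.
move=> h.
pose G t := phi (split_slot_index d n t) * (I (split_slot_index d n t))%:R.
have {}h : \int[w]_t G t * P <= A * P'.
  apply: h => i j Ii Ij ij.
    by rewrite /phi ler_wpM2l // ler_nat leq_sub2r // ltnW.
  split; last left.
    move=> t /=; rewrite /split_slot_index; case: ltP => t0 e.
      by move: Ij; rewrite /I -e ltnNge slot_index_lt0.
    case: j Ij ij e => // j Ij ij e; apply/(slotE n d_gt0).
    move: e; rewrite /maxn; case: ifP => // _ e.
    by move: ij; rewrite -e ltnS leqNgt (Ii : (n < i)%N).
  move=> t st; rewrite /= /split_slot_index ltNge (slot_ge0 d_gt0 _ st) /=; last first.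
    exact: leqW (ltnW Ii).
  by rewrite (slot_sub d_gt0 st) (maxn_idPr _).
have low : A' - 2 * d * P' <= \int[w]_t G t.
  have ip := integrable_pos_part c_gt0 wg.
  have ir : w.-integrable setT (EFin \o (fun t : R => (0 <= t)%R%:R : R)).
    by apply: (@integrable_indicator (fun t => 0 <= t)); apply: measurable_fun_ler.
  have -> : A' - 2 * d * P' =
      1 * \int[w]_t pos_part t + (- (2 * d)) * \int[w]_t ((0 <= t)%R%:R : R).
    by rewrite integral_pos_partR integral_rightR; ring.
  rewrite -Rintegral_lin2 //; apply: le_Rintegral => //.
  - exact: (integrableD measurableT (integrableZl measurableT 1 ip)
      (integrableZl measurableT _ ir)).
  - exact: (integrable_split bC).
  - move=> t _; rewrite /G /I split_slot_index_gt /phi.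
    case: (lerP 0 t) => t0; last first.
      by have [-> _] := neg_partE (ltW t0); rewrite !mulr0 addr0.
    have [-> _] := pos_partE t0.
    rewrite natrB; last by apply: ltnW; rewrite split_slot_index_gt.
    have := slot_index_bound n d_gt0 t.
    have : d * (slot_index d n t)%:R <= d * (split_slot_index d n t)%:R.
      by rewrite ler_wpM2l // ler_nat /split_slot_index ltNge t0 /= leq_maxr.
    by rewrite /= !mulr1; lra.
have P0 : 0 <= P by apply: ltW; exact: (prob_above_gt0 c_gt0 d_gt0 rate0 balance).
have := ler_wpM2r P0 low; lra.
Qed.

(** The same comparison conditionally on lying below the kink, where a larger value
    means a smaller shortfall. *)
Lemma mean_below_order : B * F' <= (B' + 2 * d * F') * (1 - P).
Proof.
have d0 := ltW d_gt0.
pose I := (fun k => k <= n)%N; pose phi (k : nat) : R := - (d * (n - k)%:R).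
have phiC k : `|phi k| <= d * n%:R * (1 + k%:R).
  rewrite normrN ger0_norm ?mulr_ge0 // -mulrA ler_wpM2l //.
  by rewrite mulrDr mulr1 (@le_trans _ _ n%:R) ?lerDl ?mulr_ge0 // ler_nat leq_subr.
have bC k : `|phi k * (I k)%:R| <= d * n%:R * (1 + k%:R).
  rewrite normrM [X in _ * X]ger0_norm // (le_trans _ (phiC k)) //.
  by case: (I k); rewrite ?mulr1 ?mulr0.
have Iz t : I (split_slot_index d n t) = (t < 0).
  by rewrite /I leqNgt split_slot_index_gt ltNge.
have := @discretized_order (split_slot_index d n) I phi _ _
   (measurable_split_slot_index n d_gt0) split_slot_index_growth phiC.
have -> : \int[w]_t ((I (split_slot_index d n t))%:R : R) = F'.
  by rewrite -integral_leftR; apply: eq_Rintegral => t _; rewrite Iz.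
have -> : \int[nu]_k ((I k)%:R : R) = 1 - P.
  exact: (prob_below c_gt0 d_gt0 rate0 balance).
have -> : \int[nu]_k (phi k * (I k)%:R) = - B.
  rewrite /B /mean_below -mulN1r -RintegralZl //; last first.
    exact: (integrable_shortfall c_gt0 d_gt0 rate0 balance).
  apply: eq_Rintegral => k _; rewrite /I /phi; case: leqP => nk.
    by rewrite mulr1 mulN1r.
  by rewrite (eqP (_ : (n - k)%N == 0%N)) ?subn_eq0 ?(ltnW nk) // !mulr0.
move=> h.
pose G t := phi (split_slot_index d n t) * (I (split_slot_index d n t))%:R.
have {}h : \int[w]_t G t * (1 - P) <= - B * F'.
  apply: h => i j Ii Ij ij.
    by rewrite /phi lerN2 ler_wpM2l // ler_nat leq_sub2l // ltnW.
  have zj t : split_slot_index d n t = j -> t < 0 /\ slot d n j t.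
    move=> e; have t0 : t < 0 by rewrite -Iz e.
    split => //; move: e; rewrite /split_slot_index t0.
    by case: j ij {Ij} => // j _ /(slotE n d_gt0).
  split; first by move=> t /zj[].
  have [i2|i2] := leqP i.+2 n.
    left => t st; rewrite /= /split_slot_index (slot_lt0 d_gt0 i2 st).
    exact: (slot_sub d_gt0 st).
  (* now [i = n - 1] and [j = n], and slot [n] lies above the kink *)
  right; apply/seteqP; split => // t /zj[t0 st].
  have : 0 <= t.
    by apply: (slot_ge0 d_gt0 _ st); exact: leq_trans (i2 : (n <= i.+1)%N) (leqW ij).
  by rewrite leNgt t0.
have low : - B' - 2 * d * F' <= \int[w]_t G t.
  have ip := integrable_neg_part wg.
  have ir : w.-integrable setT (EFin \o (fun t : R => (t < 0)%R%:R : R)).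
    by apply: (@integrable_indicator (fun t => t < 0)); apply: measurable_fun_ltr.
  have -> : - B' - 2 * d * F' =
      (-1) * \int[w]_t neg_part t + (- (2 * d)) * \int[w]_t ((t < 0)%R%:R : R).
    by rewrite integral_neg_partR integral_leftR; ring.
  rewrite -Rintegral_lin2 //; apply: le_Rintegral => //.
  - exact: (integrableD measurableT (integrableZl measurableT (-1) ip)
      (integrableZl measurableT _ ir)).
  - exact: (integrable_split bC).
  - move=> t _; rewrite /G Iz /phi; case: (ltrP t 0) => t0; last first.
      by have [_ ->] := pos_partE t0; rewrite !mulr0 addr0.
    have [_ ->] := neg_partE (ltW t0).
    rewrite natrB; last by have := Iz t; rewrite t0.
    rewrite /split_slot_index t0.
    by have := slot_index_bound n d_gt0 t; rewrite /= !mulr1; lra.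
have P1 : 0 <= 1 - P.
  by rewrite subr_ge0 ltW //; exact: (prob_above_lt1 c_gt0 d_gt0 rate0 balance).
have := ler_wpM2r P1 low; lra.
Qed.

Definition overshoot_const : R := 3 + 2 * (expR 2 + 2) ^+ 2.

Lemma right_left_mass : P' + F' = 1.
Proof.
rewrite -integral_rightR -integral_leftR -RintegralD //; last 2 first.
- by apply: (@integrable_indicator (fun t => 0 <= t)); apply: measurable_fun_ler.
- by apply: (@integrable_indicator (fun t => t < 0)); apply: measurable_fun_ltr.
transitivity (\int[w]_t (1 : R)); last exact: Rintegral_probability_cst.
apply: eq_Rintegral => t _.
by case: (ltrP t 0) => _ /=; rewrite ?addr0 ?add0r.
Qed.

Lemma drift_above : c * A' = k0 - beta * P'.
Proof. by rewrite -[X in X - _]mulr1 -(tail_moment01 beta c_gt0) /A' /P'; ring. Qed.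

Lemma drift_below : B' = k0 + beta * F'.
Proof.
by rewrite -[X in X + _]mulr1 -(tail_moment01 (- beta) (@ltr01 R)) /B' /F'; ring.
Qed.

(** It remains to bound [P' (1 - P') / k0].  If the restoring force [beta] at the
    kink is at least [1] then the right tail is light, [P' <= k0]; otherwise the
    slope [- beta] at the origin of the reflected left tail is at least [-1], and
    [tail_moment0_bound] applies. *)
Lemma mean_above_le : A - A' <= overshoot_const * d.
Proof.
have k0_gt0 := density_const_gt0 wg.
have P'0 : 0 < P' by rewrite mulr_gt0 // tail_moment0_gt0.
have F'0 : 0 < F' by rewrite mulr_gt0 // tail_moment0_gt0.
have eF : F' = 1 - P' by rewrite -right_left_mass addrAC subrr add0r.
have K0 : 0 <= expR 2 + 2 :> R by rewrite addr_ge0 // expR_ge0.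
have A'0 : 0 <= A' by rewrite mulr_ge0 ?tail_moment_ge0 // ltW.
have B'0 : 0 <= B' by rewrite mulr_ge0 ?tail_moment_ge0 // ltW.
have cA' := drift_above; have eB' := drift_below; rewrite eF in eB'.
apply: (overshoot_bound c_gt0 d_gt0 k0_gt0 _ _ P'0 _ A'0 B'0 K0
  (mean_above_eq c_gt0 d_gt0 rate0 balance)
  (mean_below_eq c_gt0 d_gt0 rate0 balance) cA' eB') => //.
- exact: (prob_above_gt0 c_gt0 d_gt0 rate0 balance).
- exact: (prob_above_lt1 c_gt0 d_gt0 rate0 balance).
- by rewrite -subr_gt0 -eF.
- have := ler_wpM2l (ltW k0_gt0) (hazard_le c_gt0 d_gt0 rate0 balance).
  rewrite -/P => h; have := h; rewrite /P'; lra.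
- exact: mean_above_order.
- by rewrite -eF; exact: mean_below_order.
- have := ler_wpM2l (sqr_ge0 k0) (tail_moment1_le beta c_gt0).
  by rewrite /A' /P'; lra.
- rewrite -eF; have [b1|b1] := lerP 1 beta.
    have h1 : P' <= k0.
      have : 0 <= c * A' by rewrite mulr_ge0 // ltW.
      have : P' <= beta * P' by rewrite ler_peMl // ltW.
      by lra.
    have h2 : F' * P' <= 1 * P' by rewrite ler_wpM2r ?(ltW P'0) // eF gerBl ltW.
    have : 1 * k0 <= (expR 2 + 2) * k0.
      by rewrite ler_wpM2r ?(ltW k0_gt0) //; have := expR_ge0 (2 : R); lra.
    by lra.
  have b1' : -1 <= - beta by rewrite lerN2 ltW.
  have h1 : F' <= (expR 2 + 2) * k0.
    by rewrite mulrC ler_wpM2l ?(ltW k0_gt0) // tail_moment0_bound.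
  apply: le_trans h1; rewrite ler_piMr ?(ltW F'0) //.
  by rewrite -right_left_mass lerDl ltW.
Qed.

(** The stochastic order, applied to the positive part. *)
Lemma mean_above_ge : A' - 2 * d <= A.
Proof.
have d0 := ltW d_gt0.
have := @stochastic_order (@pos_part R) 1.
rewrite integral_pos_partR => h.
have {}h : A' <= \int[nu]_k pos_part (d * (k%:R - n%:R) + d + d).
  apply: h => [x y xy|t].
    by rewrite /pos_part ge_max !le_max xy lexx !orbT.
  rewrite mul1r ger0_norm ?pos_part_ge0 // ge_max addr_ge0 // andbT.
  by rewrite (le_trans (ler_norm _)) // lerDr.
have ie := integrable_excess c_gt0 d_gt0 rate0 balance.
have i1 : nu.-integrable setT (EFin \o (fun=> 2 * d : R)).
  exact: finite_measure_integrable_cst.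
have : \int[nu]_k pos_part (d * (k%:R - n%:R) + d + d) <=
   \int[nu]_k (d * (k - n)%:R + 2 * d).
  have pt k : pos_part (d * (k%:R - n%:R) + d + d) <= d * (k - n)%:R + 2 * d.
    have e0 : 0 <= d * (k - n)%:R by rewrite mulr_ge0.
    rewrite ge_max; apply/andP; split; last by lra.
    suff : d * (k%:R - n%:R) <= d * (k - n)%:R by lra.
    by rewrite ler_wpM2l // lerBlDr -natrD ler_nat addnC -leq_subLR.
  have ir : nu.-integrable setT (EFin \o (fun k => d * (k - n)%:R + 2 * d)).
    exact: (integrableD measurableT ie i1).
  apply: le_Rintegral => //.
  apply: le_integrable ir => // k _ /=; rewrite lee_fin ger0_norm ?pos_part_ge0 //.
  by rewrite (le_trans (pt k)) // ler_norm.
rewrite RintegralD // Rintegral_probability_cst.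
by rewrite -/(mean_above d n nu) -/A; lra.
Qed.

(** Both [t + h t] and [t - h t] are nondecreasing, so the stochastic order bounds
    the difference of the means of [h] by the difference of the means of the laws,
    up to the shift by two steps.  As both laws satisfy
    [c * (mean excess) - (mean shortfall) = - beta], the difference of the means is
    [1 - c] times the difference of the mean excesses. *)
Lemma lipschitz_comparison (h : R -> R) : (forall x y, `|h x - h y| <= `|x - y|) ->
  [/\ w.-integrable setT (EFin \o h),
      nu.-integrable setT (EFin \o (fun k => h (d * (k%:R - n%:R)))) &
  `| \int[nu]_k h (d * (k%:R - n%:R)) - \int[w]_t h t | <=
    (overshoot_const + 2 * c + 4) * d].
Proof.
move=> hL; have d0 := ltW d_gt0.
have up : {homo (fun t => t + h t) : x y / x <= y}.
  move=> x y xy; have := hL x y; rewrite ler_norml => /andP[_].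
  by rewrite ler0_norm ?subr_le0 //; lra.
have down : {homo (fun t => t - h t) : x y / x <= y}.
  move=> x y xy; have := hL x y; rewrite ler_norml => /andP[+ _].
  by rewrite ler0_norm ?subr_le0 //; lra.
have h0t t : `|h t| <= `|h 0| + `|t|.
  have := hL t 0; rewrite subr0 => ht.
  by rewrite -[h t](subrK (h 0)) addrC (le_trans (ler_normD _ _)) // lerD2l.
set K := 2 + `|h 0|.
have hK t : `|h t| <= (K - 1) * (1 + `|t|).
  have := mulr_ge0 (normr_ge0 (h 0)) (normr_ge0 t); have := h0t t; rewrite /K; lra.
have upK t : `|t + h t| <= K * (1 + `|t|).
  rewrite (le_trans (ler_normD _ _)) //; have := hK t; lra.
have downK t : `|t - h t| <= K * (1 + `|t|).
  rewrite (le_trans (ler_normB _ _)) //; have := hK t; lra.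
have mh : measurable_fun [set: Rm] (h : Rm -> Rm).
  have -> : (h : Rm -> Rm) = (fun t => (t + h t) - t) by apply/funext => t; ring.
  by apply: measurable_funB => //; exact: nondecreasing_measurable.
have ih : w.-integrable setT (EFin \o h).
  exact: (integrable_linear_growth c_gt0 wg mh hK).
have iid : w.-integrable setT (EFin \o (fun t : R => t)).
  apply: (@integrable_linear_growth _ _ _ _ _ c_gt0 wg _ 1) => //.
  by move=> t; rewrite mul1r lerDr.
pose v (k : nat) : R := d * (k%:R - n%:R).
have vK k : `|v k| <= (d * (1 + n%:R)) * (1 + k%:R).
  have [k0_ n0_] : 0 <= k%:R :> R /\ 0 <= n%:R :> R by [].
  rewrite normrM gtr0_norm // -mulrA ler_wpM2l //.
  have := mulr_ge0 n0_ k0_ => nk; rewrite ler_norml; apply/andP; split; lra.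
have growth (f : R -> R) L : (forall t, `|f t| <= L * (1 + `|t|)) ->
    nu.-integrable setT (EFin \o (fun k => f (v k))) /\
    nu.-integrable setT (EFin \o (fun k => f (v k + d + d))).
  move=> fL.
  have L0 : 0 <= L by have := le_trans (normr_ge0 _) (fL 0); rewrite normr0 addr0 mulr1.
  have dk (k : nat) : 0 <= (1 + 2 * d) * k%:R.
    by rewrite mulr_ge0 // addr_ge0 // mulr_ge0.
  split; apply: (@integrable_linear_growth_nat _ _ _ _ _ _ c_gt0 d_gt0 rate0 balance _
      (L * (1 + d * (1 + n%:R) + 2 * d))) => k;
    rewrite (le_trans (fL _)) // -mulrA ler_wpM2l //.
    by have := vK k; have := dk k; lra.
  have := ler_normD (v k + d) d; have := ler_normD (v k) d; rewrite !(ger0_norm d0).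
  by have := vK k; have := dk k; lra.
have [ihv ihV] := growth h _ hK.
have idK (t : R) : `|t| <= 1 * (1 + `|t|) by rewrite mul1r lerDr.
have [iv iV] := growth (fun t => t) 1 idK.
split=> //.
have o1 := stochastic_order up upK; have o2 := stochastic_order down downK.
rewrite RintegralD // in o1; rewrite RintegralB // in o2.
rewrite -/(v _) RintegralD // in o1; rewrite RintegralB // in o2.
have hvV : `|\int[nu]_k h (v k) - \int[nu]_k h (v k + d + d)| <= 2 * d.
  rewrite -RintegralB // (le_trans (le_normr_Rintegral _ _)) //.
    exact: (integrableB measurableT ihv ihV).
  rewrite -[leRHS](Rintegral_probability_cst nu).
  apply: le_Rintegral => //.
  - exact: (integrable_norm (integrableB measurableT ihv ihV)).
  - exact: finite_measure_integrable_cst.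
  - move=> k _ /=; rewrite (le_trans (hL _ _)) // (_ : _ - _ = - (2 * d)); last by ring.
    by rewrite normrN ger0_norm // mulr_ge0.
have EV : \int[nu]_k (v k + d + d) = A - B + 2 * d.
  have -> : A - B + 2 * d = \int[nu]_k (d * (k - n)%:R - d * (n - k)%:R + 2 * d).
    rewrite RintegralD //; last 2 first.
    - exact: (integrableB measurableT (integrable_excess c_gt0 d_gt0 rate0 balance)
        (integrable_shortfall c_gt0 d_gt0 rate0 balance)).
    - exact: finite_measure_integrable_cst.
    rewrite RintegralB //; last 2 first.
    - exact: (integrable_excess c_gt0 d_gt0 rate0 balance).
    - exact: (integrable_shortfall c_gt0 d_gt0 rate0 balance).
    by rewrite Rintegral_probability_cst.
  apply: eq_Rintegral => k _; rewrite /v; case: (leqP n k) => nk.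
    by rewrite (eqP (_ : (n - k)%N == 0%N)) // natrB //; ring.
  rewrite (eqP (_ : (k - n)%N == 0%N)) ?subn_eq0 ?(ltnW nk) //.
  by rewrite natrB ?(ltnW nk) //; ring.
have Ew : \int[w]_t t = A' - B'.
  rewrite -integral_pos_partR -integral_neg_partR -RintegralB //; last 2 first.
  - exact: (integrable_pos_part c_gt0 wg).
  - exact: (integrable_neg_part wg).
  by apply: eq_Rintegral => t _; rewrite pos_partB.
have drift_nu : c * A - B = - beta.
  rewrite (mean_above_eq c_gt0 d_gt0 rate0 balance).
  by rewrite /B (mean_below_eq c_gt0 d_gt0 rate0 balance); ring.
have drift_w : c * A' - B' = - beta.
  have eF : F' = 1 - P' by rewrite -right_left_mass addrAC subrr add0r.
  by rewrite drift_above drift_below eF; ring.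
have meanD : A - B - (A' - B') <= (overshoot_const + 2 * c) * d.
  have -> : A - B - (A' - B') = (1 - c) * (A - A') by lra.
  have Dle := mean_above_le; have Dge := mean_above_ge.
  have C0 : 0 <= overshoot_const * d.
    by rewrite mulr_ge0 // addr_ge0 // mulr_ge0 // sqr_ge0.
  have cd : 0 <= c * d by rewrite mulr_ge0 // ltW.
  have [c1|c1] := lerP c 1.
    have h1 : 0 <= 1 - c by rewrite subr_ge0.
    have := ler_wpM2l h1 Dle.
    have : 0 <= c * (overshoot_const * d) by rewrite mulr_ge0 // ltW.
    by lra.
  have h1 : 0 <= c - 1 by rewrite subr_ge0 ltW.
  have := ler_wpM2l h1 Dge; lra.
move: hvV; rewrite !ler_norml => /andP[h1 h2]; apply/andP.
by rewrite EV Ew in o1 o2; split; lra.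
Qed.
End Comparison.

(** * Closed forms for the Erlang-A system *)

Section Antiderivative.
Context {R : realType}.
Notation leb := (@lebesgue_measure R).

Lemma half_sqr_pos_part_expansion (x h : R) :
  `|pos_part (x + h) ^+ 2 / 2 - pos_part x ^+ 2 / 2 - h * pos_part x| <= h ^+ 2 / 2.
Proof.
have h2 := sqr_ge0 h.
rewrite ler_norml; apply/andP.
case: (lerP 0 x) => x0; case: (lerP 0 (x + h)) => xh0.
- have [-> _] := pos_partE x0; have [-> _] := pos_partE xh0; split; lra.
- have [-> _] := pos_partE x0; have [-> _] := neg_partE (ltW xh0).
  by split; nra.
- have [-> _] := neg_partE (ltW x0); have [-> _] := pos_partE xh0.
  by split; nra.
- have [-> _] := neg_partE (ltW x0); have [-> _] := neg_partE (ltW xh0); split; lra.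
Qed.

Lemma is_derive_half_sqr_pos_part (x : R) :
  is_derive x (1 : R) (fun z => pos_part z ^+ 2 / 2) (pos_part x).
Proof.
have h : h^-1 *: (pos_part (h *: (1 : R) + x) ^+ 2 / 2 - pos_part x ^+ 2 / 2)
    @[h --> 0^'] --> pos_part x.
  apply/cvgrPdist_le => e e0; near=> h.
  have h0 : h != 0 by near: h; exact: nbhs_dnbhs_neq.
  have hn0 : 0 < `|h| by rewrite normr_gt0.
  have he : `|h| <= e.
    near: h; apply: dnbhs0_le; exact: e0.
  rewrite /GRing.scale /= mulr1 [h + x]addrC distrC.
  have -> : h^-1 * (pos_part (x + h) ^+ 2 / 2 - pos_part x ^+ 2 / 2) - pos_part x =
     h^-1 * (pos_part (x + h) ^+ 2 / 2 - pos_part x ^+ 2 / 2 - h * pos_part x) by field.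
  rewrite normrM normfV mulrC ler_pdivrMr //.
  apply: (le_trans (half_sqr_pos_part_expansion x h)).
  rewrite -real_normK ?num_real //.
  have : `|h| * `|h| <= e * `|h| by rewrite ler_pM2r.
  by have := sqr_ge0 `|h|; lra.
by apply: DeriveDef; [apply/cvg_ex; eexists; exact: h|apply: cvg_lim => //; exact: h].
Unshelve. all: by end_near. Qed.

Lemma segment_FTC (f F : R -> R) (a b : R) : a <= b -> continuous f ->
  (forall t, is_derive t (1 : R) F (f t)) -> \int[leb]_(t in `[a, b]) f t = F b - F a.
Proof.
rewrite le_eqVlt => /predU1P[-> cf dF|ab cf dF].
  by rewrite set_itv1 Rintegral_set1 subrr.
have cF : continuous F.
  by move=> x; apply/differentiable_continuous/derivable1_diffP; apply: ex_derive.
rewrite /Rintegral (continuous_FTC2 ab (F := F)) //.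
- exact: continuous_subspaceT.
- split=> //.
  + by apply: cvg_at_right_filter; exact: cF.
  + by apply: cvg_at_left_filter; exact: cF.
- by move=> x _; rewrite derive1E derive_val.
Qed.

Lemma oriented_integral_FTC (f F : R -> R) (a b : R) : continuous f ->
  (forall t, is_derive t (1 : R) F (f t)) -> oriented_integral a b f = F b - F a.
Proof.
move=> cf dF; rewrite /oriented_integral; case: ifPn => ab.
  exact: segment_FTC.
by rewrite (segment_FTC _ cf dF) ?opprB // ltW // ltNge.
Qed.
End Antiderivative.

Section ErlangDensity.
Context {R : realType}.
Variables (n : nat) (lambda mu alpha : R).
Hypotheses (lambda_gt0 : 0 < lambda) (mu_gt0 : 0 < mu) (alpha_gt0 : 0 < alpha).
Local Notation z0 := (zeta n lambda mu alpha).

(** The slope of the potential of the diffusion at its kink, that is at the point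
    where all servers are busy and the queue is empty. *)
Definition kink_slope : R := neg_part z0 - alpha / mu * pos_part z0.

Definition drift_primitive (x : R) : R :=
  - mu * (pos_part (- (x + z0)) ^+ 2 / 2 + neg_part z0 * x)
  - alpha * (pos_part (x + z0) ^+ 2 / 2 - pos_part z0 * x).

Lemma is_derive_drift_primitive (x : R) :
  is_derive x (1 : R) drift_primitive (drift n lambda mu alpha x).
Proof.
have d1 : is_derive x (1 : R) (fun x : R => x + z0) 1.
  by apply: is_derive_eq; rewrite addr0.
have d2 : is_derive x (1 : R) (fun x : R => - (x + z0)) (-1) by apply: is_derive_eq.
have h1 := @is_derive1_comp _ (fun z : R => pos_part z ^+ 2 / 2)
  (fun x : R => x + z0) x _ _ (is_derive_half_sqr_pos_part (x + z0)) d1.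
have h2 := @is_derive1_comp _ (fun z : R => pos_part z ^+ 2 / 2)
  (fun x : R => - (x + z0)) x _ _ (is_derive_half_sqr_pos_part (- (x + z0))) d2.
rewrite /comp in h1 h2.
apply: is_derive_eq; rewrite -[1]/(1 : R) /GRing.scale/= /drift -!/(pos_part _).
rewrite /neg_part -!/(pos_part _); ring.
Qed.

Lemma continuous_drift : continuous (drift n lambda mu alpha).
Proof.
have cp : continuous (@pos_part R).
  by move=> x; apply: continuous_max; [exact: cvg_id|exact: cvg_cst].
have cs : continuous (fun x : R => x + z0).
  by move=> x; apply: cvgD; [exact: cvg_id|exact: cvg_cst].
have cps : continuous (fun x : R => pos_part (x + z0)).
  by move=> x; apply: (continuous_comp (cs x)); exact: cp.
have cns : continuous (fun x : R => neg_part (x + z0)).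
  move=> x; apply: (continuous_comp (f := fun x : R => - (x + z0)) (g := @pos_part R)).
    by apply: cvgN; exact: cs.
  exact: cp.
move=> x; apply: cvgB; apply: cvgM; try exact: cvg_cst.
- by apply: cvgB; [exact: cns|exact: cvg_cst].
- by apply: cvgB; [exact: cps|exact: cvg_cst].
Qed.

Definition density_factor : R :=
  expR (neg_part z0 ^+ 2 / 2 + alpha / mu / 2 * pos_part z0 ^+ 2 + kink_slope * z0).

Lemma unnormalized_densityE (x : R) : unnormalized_density n lambda mu alpha x =
  density_factor * two_sided_gauss kink_slope (alpha / mu) (x + z0).
Proof.
rewrite /unnormalized_density.
rewrite (oriented_integral_FTC _ _ continuous_drift is_derive_drift_primitive).
rewrite /density_factor /two_sided_gauss -expRD; congr expR.
have en y : pos_part (- y) = neg_part y by [].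
by rewrite /drift_primitive !add0r !en /kink_slope; field; rewrite gt_eqF.
Qed.

Lemma diffusion_densityE (x : R) : diffusion_density n lambda mu alpha x =
  kappa n lambda mu alpha * density_factor *
  two_sided_gauss kink_slope (alpha / mu) (x + z0).
Proof. by rewrite /diffusion_density unnormalized_densityE mulrA. Qed.

Local Notation d := (delta lambda mu).
Local Notation rho := (offered_load lambda mu).

Lemma offered_load_gt0 : 0 < rho. Proof. by rewrite divr_gt0. Qed.

Lemma delta_gt0 : 0 < d.
Proof. by rewrite divr_gt0 // sqrtr_gt0 offered_load_gt0. Qed.

Lemma delta_sqr : d ^+ 2 * rho = 1.
Proof.
have r0 := offered_load_gt0.
by rewrite /delta expr_div_n sqr_sqrtr ?(ltW r0) // expr1n div1r mulVf // gt_eqF.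
Qed.

(** The two definitions of the fluid equilibrium give the same formula, because the
    fluid drift is affine on each side of the kink and vanishes at the
    equilibrium. *)
Lemma kink_slopeE : kink_slope = d * (n%:R - rho).
Proof.
have d0 := ltW delta_gt0; rewrite /kink_slope /zeta /x_infty; case: ifPn => nr.
  have e : (lambda - n%:R * mu) / alpha = mu / alpha * (rho - n%:R).
    by rewrite /offered_load; field; rewrite !gt_eqF.
  have h : 0 <= d * (n%:R + (lambda - n%:R * mu) / alpha - n%:R).
    rewrite mulr_ge0 // addrAC subrr add0r e mulr_ge0 ?subr_ge0 //.
    by rewrite divr_ge0 // ltW.
  have [-> ->] := pos_partE h; rewrite e; field; by rewrite !gt_eqF.
have h : d * (rho - n%:R) <= 0.
  by rewrite mulr_ge0_le0 // subr_le0 ltW // ltNge.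
by have [-> ->] := neg_partE h; ring.
Qed.

(** The drift of the diffusion is, up to scaling, the birth rate minus the death
    rate of the chain at the corresponding state. *)
Lemma rate_erlangA k :
  rate kink_slope (alpha / mu) d n k = erlangA_death n mu alpha k / lambda.
Proof.
have r0 : rho != 0 by rewrite gt_eqF // offered_load_gt0.
have e : 1 + d * kink_slope = n%:R / rho.
  apply: (mulIf r0); rewrite divfK // kink_slopeE.
  have -> : (1 + d * (d * (n%:R - rho))) * rho =
      rho + d ^+ 2 * rho * (n%:R - rho) by ring.
  by rewrite delta_sqr; ring.
have d2 : d ^+ 2 = rho^-1 by apply: (mulIf r0); rewrite delta_sqr mulVf.
have d0 := delta_gt0.
rewrite /erlangA_death; case: (leqP k n) => kn.
  rewrite (rate_below _ _ d0 kn) e (eqP (_ : (k - n)%N == 0%N)) // mulrA -expr2 d2.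
  by rewrite natrB // /offered_load; field; rewrite !gt_eqF.
rewrite (rate_above _ _ d0 (ltnW kn)) e.
rewrite [X in _ + X](_ : _ = alpha / mu * d ^+ 2 * (k - n)%:R); last by ring.
by rewrite d2 /offered_load; field; rewrite !gt_eqF.
Qed.
End ErlangDensity.

Lemma integral_distribution_gen (d d' : measure_display) (T : measurableType d)
    (T' : measurableType d') (R : realType) (P : probability T R)
    (X : {mfun T >-> T'}) (f : T' -> \bar R) : measurable_fun setT f ->
  (\int[distribution P X]_y f y = \int[P]_x f (X x))%E.
Proof.
move=> mf.
have e (g : T' -> \bar R) (g' : T -> \bar R) : measurable_fun setT g ->
    (forall y, 0 <= g y)%E -> (forall x, g (X x) = g' x) ->
    (\int[distribution P X]_y g y = \int[P]_x g' x)%E.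
  move=> mg g0 gg'; rewrite ge0_integral_distribution //.
  by apply: eq_integral => x _ /=.
rewrite integralE [RHS]integralE; congr (_ - _)%E; apply: e => //.
- exact: measurable_funepos.
- by move=> x; rewrite unlock.
- exact: measurable_funeneg.
- by move=> x; rewrite unlock.
Qed.

Section Bridge.
Context {R : realType}.
Notation Rm := (measurableTypeR R).
Variables (n : nat) (lambda mu alpha : R).
Hypotheses (lambda_gt0 : 0 < lambda) (mu_gt0 : 0 < mu) (alpha_gt0 : 0 < alpha).
Local Notation z0 := (zeta n lambda mu alpha).
Local Notation d := (delta lambda mu).
Local Notation c := (alpha / mu).
Local Notation beta := (kink_slope n lambda mu alpha).
Local Notation rate_ := (rate beta c d n).

Lemma erlangA_balance (Pt : R -> R.-pker nat ~> nat) (nu : probability nat R) :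
  erlangA n lambda mu alpha Pt -> stationary Pt nu ->
  rate_ 0 = 0 /\ forall k, rate_ k.+1 * mass nu k.+1 = mass nu k.
Proof.
move=> [_ rates] st; split.
  by rewrite rate_erlangA // /erlangA_death min0n sub0n !mulr0 addr0 mul0r.
move=> k; rewrite rate_erlangA // mulrAC.
have death0 j : 0 <= erlangA_death n mu alpha j.
  by rewrite addr_ge0 // mulr_ge0 // ltW.
have := @detailed_balance _ _ _ st (erlangA_birth lambda)
  (erlangA_death n mu alpha) lambda (fun=> lexx _) death0 rates k.
by rewrite /erlangA_birth => <-; rewrite mulrAC mulfV ?mul1r // gt_eqF.
Qed.

(** [Y + zeta] is the diffusion with its kink moved to the origin. *)
Lemma shifted_diffusion (d' : measure_display) (T' : measurableType d')
    (P' : probability T' R) (Y : {RV P' >-> R}) :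
  has_density Y (diffusion_density n lambda mu alpha) ->
  exists w : probability Rm R, exists k0 : R,
    is_density w (fun t => k0 * two_sided_gauss beta c t) /\
    forall h : R -> R, measurable_fun [set: Rm] (h : Rm -> Rm) ->
      (\int[P']_t (h (Y t + z0))%:E = \int[w]_t (h t)%:E)%E.
Proof.
move=> dY.
have mY : measurable_fun setT (Y : T' -> Rm) by exact: (measurable_funPT Y).
pose Y0 : {mfun T' >-> Rm} := HB.pack (Y : T' -> Rm)
  (@isMeasurableFun.Build _ _ _ _ _ mY).
pose s : {mfun Rm >-> Rm} := HB.pack (fun x : Rm => (x + z0 : Rm))
  (@isMeasurableFun.Build _ _ _ _ _ (measurable_addr z0)).
pose k0 := kappa n lambda mu alpha * density_factor n lambda mu alpha.
have k0_ge0 : 0 <= k0.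
  rewrite mulr_ge0 // ?expR_ge0 // invr_ge0.
  by apply: Rintegral_ge0 => x _; exact: expR_ge0.
exists (distribution (distribution P' Y0) s), k0; split.
  have dY0 : is_density (distribution P' Y0) (diffusion_density n lambda mu alpha).
    by move=> A mA; exact: dY.
  have fE : diffusion_density n lambda mu alpha \o (fun x => x - z0) =
      (fun t => k0 * two_sided_gauss beta c t).
    by apply/funext => t /=; rewrite diffusion_densityE // subrK.
  rewrite -fE; apply: density_pushforward => //.
  - by move=> x; rewrite diffusion_densityE // mulr_ge0 // expR_ge0.
  - rewrite fE; apply: measurable_funM => //; exact: measurable_two_sided_gauss.
  - exact: addrK.
  - by move=> A mA; exact: lebesgue_measure_shift.
move=> h mh; have mEh : measurable_fun [set: Rm] (EFin \o h) by exact/measurable_EFinP.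
have mEhs : measurable_fun [set: Rm] (fun x => (h (x + z0))%:E).
  by apply: (measurableT_comp mEh); exact: measurable_addr.
by rewrite [RHS](@integral_distribution_gen _ _ _ _ _ _ s _ mEh)
  (@integral_distribution_gen _ _ _ _ _ _ Y0 _ mEhs).
Qed.
End Bridge.

Unset Implicit Arguments.
Set Strict Implicit.

Theorem theorem2p1 (R : realType) :
  exists C_W : R -> R,
    (forall x : R, 0 <= x -> 0 <= C_W x) /\
    (forall x y : R, 0 <= x -> x < y -> C_W x < C_W y) /\
    forall (n : nat) (lambda mu alpha : R),
      (1 <= n)%N -> 0 < lambda -> 0 < mu -> 0 < alpha ->
      1 <= offered_load lambda mu ->
    forall Pt : R -> R.-pker nat ~> nat,
      erlangA n lambda mu alpha Pt ->
    forall (d : measure_display) (T : measurableType d) (P : probability T R)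
      (X : {RV P >-> nat}),
      stationary Pt (distribution P X) ->
    forall (d' : measure_display) (T' : measurableType d')
      (P' : probability T' R) (Y : {RV P' >-> R}),
      has_density Y (diffusion_density n lambda mu alpha) ->
    (wasserstein P P' (scaled_count n lambda mu alpha \o X) Y
       <= (C_W (alpha / mu) * delta lambda mu)%:E)%E.
Proof.
exists (fun x => overshoot_const + 2 * x + 4).
have C0 : 0 <= overshoot_const :> R.
  by rewrite addr_ge0 // mulr_ge0 // sqr_ge0.
split; first by move=> x x0; lra.
split; first by move=> x y _ xy; lra.
move=> n lambda mu alpha _ l0 m0 a0 _ Pt PtA d T P X st d' T' P' Y dY.
have [r0 bal] := erlangA_balance l0 m0 a0 PtA st.
have [w [k0 [wg wY]]] := shifted_diffusion m0 dY.
have c0 : 0 < alpha / mu by rewrite divr_gt0.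
have d0 := delta_gt0 l0 m0.
rewrite /wasserstein; apply: ge_ereal_sup => _ [h hL <-].
set z0 := zeta n lambda mu alpha in wY.
(* with the kinks of both laws moved to the origin *)
pose g t := h (t - z0).
have hLip x y : `|h x - h y| <= `|x - y|.
  by have := hL (x, y); rewrite /= mul1r; apply.
have gLip x y : `|g x - g y| <= `|x - y|.
  by rewrite (le_trans (hLip _ _)) // opprB addrA subrK.
have [iw inu le] := lipschitz_comparison c0 d0 wg r0 bal gLip.
have mg : measurable_fun [set: measurableTypeR R]
    (g : measurableTypeR R -> measurableTypeR R).
  by apply/measurable_EFinP; exact: (measurable_int w iw).
have EX : ('E_P[h \o (scaled_count n lambda mu alpha \o X)])%E =
    (\int[distribution P X]_k (g (delta lambda mu * (k%:R - n%:R))))%:E.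
  rewrite /Rintegral fineK; last exact: integrable_fin_num inu.
  rewrite integral_distribution_gen // expectation.unlock.
  apply: eq_integral => x _ /=; congr (h _)%:E.
  by rewrite /scaled_count /z0 /zeta; ring.
have EY : ('E_P'[h \o Y])%E = (\int[w]_t g t)%:E.
  rewrite /Rintegral fineK; last exact: integrable_fin_num iw.
  rewrite -wY // expectation.unlock.
  by apply: eq_integral => x _ /=; rewrite /g addrK.
by rewrite EX EY -EFinB abse_EFin lee_fin.
Qed.
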